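(* Let $G$ be a finite simple graph with maximum degree $3$ that is claw-free (contains no induced $K_{1,3}$) and decomposable. Then $\chi'_{\mathrm{irr}}(G) \le 3$, i.e., $G$ admits a locally irregular edge-coloring using at most $3$ colors.
   Context: A graph is locally irregular if no two adjacent vertices have the same degree. A locally irregular edge-coloring of a graph $G$ is an (not necessarily proper) edge-coloring such that, for each color, the subgraph formed by the edges of that color (with their endvertices) is locally irregular; equivalently, for every edge $uv$ of color $i$, the number of edges of color $i$ incident with $u$ differs from the number of edges of color $i$ incident with $v$. A graph is decomposable if it admits a locally irregular edge-coloring, and for a decomposable graph $G$, $\chi'_{\mathrm{irr}}(G)$ denotes the minimum number of colors in a locally irregular edge-coloring of $G$. *)

(* Defs.v *)
From HB Require Import structures.
From mathcomp Require Import all_boot.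

Set Implicit Arguments.
Unset Strict Implicit.
Unset Printing Implicit Defensive.

Record sgraph (T : finType) := SGraph {
  adj :> rel T;
  adj_sym : symmetric adj;
  adj_irr : irreflexive adj }.

Definition deg (T : finType) (G : sgraph T) (v : T) : nat := #|[set w | G v w]|.

Definition max_deg (T : finType) (G : sgraph T) : nat := \max_(v : T) deg G v.

Definition has_induced (S T : finType) (H : sgraph S) (G : sgraph T) : Prop :=
  exists f : S -> T, injective f /\ forall x y, G (f x) (f y) = H x y.

(* K_{1,3}: the center is None, the leaves are Some i. *)
Definition claw_adj : rel (option 'I_3) :=
  fun x y => (x == None) != (y == None).

Lemma claw_adj_sym : symmetric claw_adj.
Proof. by move=> x y; rewrite /claw_adj eq_sym. Qed.

Lemma claw_adj_irr : irreflexive claw_adj.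
Proof. by move=> x; rewrite /claw_adj eqxx. Qed.

Definition claw : sgraph (option 'I_3) := SGraph claw_adj_sym claw_adj_irr.

Definition claw_free (T : finType) (G : sgraph T) : Prop := ~ has_induced claw G.

Definition locally_irregular (T : finType) (G : sgraph T) : bool :=
  [forall u, forall v, G u v ==> (deg G u != deg G v)].

Definition edges (T : finType) (G : sgraph T) : {set {set T}} :=
  [set [set p.1; p.2] | p in [set p : T * T | G p.1 p.2]].

Definition edge (T : finType) (G : sgraph T) : finType :=
  {f : {set T} | f \in edges G}.

Definition edge_coloring (T : finType) (G : sgraph T) (k : nat) : finType :=
  {ffun edge G -> 'I_k}.

Section ColorSubgraph.
Variables (T : finType) (G : sgraph T) (k : nat).
Variables (c : edge_coloring G k) (i : 'I_k).

Definition color_adj : rel T :=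
  fun u v => [exists f : edge G, (val f == [set u; v]) && (c f == i)].

Lemma color_adj_sym : symmetric color_adj.
Proof. by move=> u v; rewrite /color_adj; apply: eq_existsb => f; rewrite setUC. Qed.

Lemma edge_adj (f : edge G) (u v : T) : val f = [set u; v] -> G u v.
Proof.
case: f => f /= /imsetP[[x y]]; rewrite inE /= => Gxy -> e.
have xy : x != y by apply: contraTneq Gxy => ->; rewrite adj_irr.
have : x \in [set u; v] by rewrite -e set21.
have : y \in [set u; v] by rewrite -e set22.
rewrite !inE => /orP[] /eqP yE /orP[] /eqP xE; move: xy Gxy;
  by rewrite xE yE ?eqxx // adj_sym.
Qed.

Lemma color_adj_irr : irreflexive color_adj.
Proof.
move=> u; apply/existsP => -[f /andP[/eqP /edge_adj]].
by rewrite adj_irr.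
Qed.

(* The subgraph formed by the edges of color i, kept on the whole vertex set:
   the extra vertices are isolated and do not affect local irregularity. *)
Definition color_subgraph : sgraph T := SGraph color_adj_sym color_adj_irr.

End ColorSubgraph.

Definition lir_coloring (T : finType) (G : sgraph T) (k : nat)
    (c : edge_coloring G k) : bool :=
  [forall i : 'I_k, locally_irregular (color_subgraph c i)].

Definition lir_colorable (T : finType) (G : sgraph T) : pred nat :=
  fun k => [exists c : edge_coloring G k, lir_coloring c].

Definition decomposable (T : finType) (G : sgraph T) : Prop :=
  exists k, lir_colorable G k.

Definition chi_irr (T : finType) (G : sgraph T) (dG : decomposable G) : nat :=
  ex_minn dG.

(* Main.v *)
Require Import Defs.
From mathcomp Require Import all_boot.
From mathcomp Require Import zify.
From Stdlib Require Import Classical.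

(* Orient the edges so that no vertex has in-degree 1.  The arcs into a vertex
   of positive in-degree (a center) form a star with 2 or 3 edges; coloring the
   centers colors the edges.  A locally irregular coloring with any number of
   colors gives such an orientation: let every edge point to its endpoint of
   larger color degree, with a correction at the vertices of color degree 3.
   Reversing a path joining two centers of in-degree 3 removes both of them, so
   that at most one of these claw centers remains in each component.

   The 3-coloring of the centers must separate the out-neighbors of every source
   and avoid a few patterns around directed triangles and the claw center.  It is
   greedy: every set S of centers has a member whose constraints inside S are all
   met by avoiding the colors of two vertices.  If the three out-neighbors of a
   source s lie in S, then two of them are adjacent, say v1 -> v2; the only other
   in-neighbor of v2 is the center v1, which makes v2 such a member, unless v2 is
   the claw center or points to it.  Those exceptions depend on the in-neighbors
   of the claw center; two configurations are first removed by moving the claw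
   center to another vertex. *)

Set Implicit Arguments.
Unset Strict Implicit.
Unset Printing Implicit Defensive.

(** * Star orientations and the constraints on the colors of their centers *)

Section Defs.
Variable T : finType.
Implicit Types (o : rel T) (S : {set T}).

Definition und o : rel T := fun x y => o x y || o y x.
Definition indeg o (x : T) := #|[set u | o u x]|.
Definition source o x := indeg o x == 0.
Definition claw_center o x := indeg o x == 3.

(** The graph is recovered as [und o], so [so_deg] and [so_cf] carry the degree bound and
    claw-freeness along when arcs are reversed. *)
Record star_orientation o : Prop := StarOrientation {
  so_asym : forall x y, o x y -> ~~ o y x;
  so_deg : forall x, #|[set y | und o x y]| <= 3;
  so_cf : forall v a b c, und o v a -> und o v b -> und o v c ->
    a <> b -> a <> c -> b <> c -> [\/ und o a b, und o a c | und o b c];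
  so_in : forall x, indeg o x != 1 }.

(** An arc takes the color of its head. [ConflictSrc] leaves a source at most one edge of each
    color. If [x -> y] has both ends of one color and [x] has in-degree 2, then [x] has three edges
    of that color; [ConflictClaw] keeps [y] from having three in-arcs, and [ConflictNsrc], with the
    triangle clause of [proper_on], from having two in-arcs and one out-arc of that color. The [R]
    copies make the relation symmetric. *)
Variant conflict o x y : Prop :=
| ConflictSrc s of source o s & o s x & o s y & x <> y
| ConflictClaw of o x y & claw_center o y
| ConflictClawR of o y x & claw_center o x
| ConflictNsrc of o x y & (forall u, o u x -> ~~ source o u)
| ConflictNsrcR of o y x & (forall u, o u y -> ~~ source o u).

(* A color of [c] other than those of [x] and [y] meets every constraint that
   involves [c] and members of [S] only. *)
Definition low o S c := exists x y,
  (forall z, z \in S -> conflict o c z -> z = x \/ z = y) /\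
  (forall e f, e \in S -> f \in S -> o c e -> o e f -> o f c ->
     [\/ e = x, e = y, f = x | f = y]).

Definition proper_on o S (col : T -> 'I_3) :=
  (forall x y, x \in S -> y \in S -> conflict o x y -> col x <> col y) /\
  (forall x y z, x \in S -> y \in S -> z \in S -> o x y -> o y z -> o z x ->
     ~ (col x = col y /\ col y = col z)).

(** Such a source forbids two colors to each of its out-neighbors, which is all that [low]
    allows. *)
Definition full o S s := exists x y z,
  [/\ x \in S, y \in S & z \in S] /\ [/\ o s x, o s y & o s z] /\
  [/\ source o s, x <> y, x <> z & y <> z].

End Defs.

(** * Local structure of a star orientation *)

Section Orientation.
Variables (T : finType) (o : rel T).
Hypothesis so : star_orientation o.
Implicit Types (S : {set T}).
Local Notation src := (source o).
Local Notation clw := (claw_center o).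

Lemma asymF x y : o x y -> o y x -> False.
Proof. by move=> /(so_asym so)/negP. Qed.

Lemma irrF x y : o x y -> x <> y.
Proof. by move=> h e; subst y; apply: (asymF h h). Qed.

Lemma arcF x y z : o x y -> o y z -> x <> z.
Proof. by move=> h h' e; subst z; apply: (asymF h h'). Qed.

Lemma undl x y : o x y -> und o x y.
Proof. by rewrite /und => ->. Qed.

Lemma undr x y : o x y -> und o y x.
Proof. by rewrite /und orbC => ->. Qed.

Lemma card4F (A : {set T}) a b c d : #|A| <= 3 -> a \in A -> b \in A -> c \in A ->
  d \in A -> a <> b -> a <> c -> a <> d -> b <> c -> b <> d -> c <> d -> False.
Proof.
move=> A3 aA bA cA dA /eqP ab /eqP ac /eqP ad /eqP bc /eqP bd /eqP cd.
have /card_uniqP e : uniq [:: a; b; c; d].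
  by rewrite /= !inE !negb_or ab ac ad bc bd cd.
have : #|[:: a; b; c; d]| <= #|A|.
  by apply/subset_leq_card/subsetP=> x; rewrite !inE => /or4P[] /eqP->.
by rewrite e /= => h; move: (leq_trans h A3).
Qed.

Lemma deg4F x a b c d : und o x a -> und o x b -> und o x c -> und o x d ->
  a <> b -> a <> c -> a <> d -> b <> c -> b <> d -> c <> d -> False.
Proof. by move=> *; apply: (@card4F _ a b c d (so_deg so x)); rewrite ?inE. Qed.

Lemma nsrc_in u x : o u x -> ~~ src x.
Proof.
by move=> ux; rewrite /source -lt0n; apply/card_gt0P; exists u; rewrite inE.
Qed.

Lemma srcF u x : src x -> o u x -> False.
Proof. by move=> sx /nsrc_in; rewrite sx. Qed.

Lemma nsrc_ex x : ~~ src x -> exists u, o u x.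
Proof. by rewrite /source -lt0n => /card_gt0P[u]; rewrite inE; exists u. Qed.

Lemma other_in p x : o p x -> exists2 q, o q x & q <> p.
Proof.
move=> px; have h := so_in so x; have h0 := nsrc_in px.
have : 1 < indeg o x.
  by move: h h0; rewrite /source /indeg; case: #|_| => [|[]].
case/card_gt1P=> q [r [+ + qr]]; rewrite !inE => qx rx.
case: (eqVneq q p) => [e|/eqP]; last by exists q.
by exists r => //; move=> e'; rewrite e e' eqxx in qr.
Qed.

Lemma clw3 a b c x : o a x -> o b x -> o c x -> a <> b -> a <> c -> b <> c -> clw x.
Proof.
move=> ax bx cx /eqP ab /eqP ac /eqP bc; rewrite /clw /claw_center eqn_leq.
apply/andP; split.
  apply: leq_trans (so_deg so x); apply/subset_leq_card/subsetP=> u.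
  by rewrite !inE => /undr.
have /card_uniqP e : uniq [:: a; b; c] by rewrite /= !inE !negb_or ab ac bc.
have -> : 3 = #|[:: a; b; c]| by rewrite e.
by apply/subset_leq_card/subsetP=> u; rewrite !inE => /or3P[] /eqP->.
Qed.

Lemma ins2 p q r x : ~~ clw x -> o p x -> o q x -> p <> q -> o r x -> r = p \/ r = q.
Proof.
move=> nc px qx pq rx.
case: (r =P p) => [|rp]; first by left.
case: (r =P q) => [|rq]; first by right.
by case/negP: nc; apply: (clw3 rx px qx).
Qed.

(** A center has at least two in-arcs, so the degree bound leaves room for one out-arc. *)
Lemma out_uniq x y z : ~~ src x -> o x y -> o x z -> y = z.
Proof.
case/nsrc_ex=> p px xy xz; have [q qx qp] := other_in px.
case: (y =P z) => // yz.
by case: (deg4F (undr px) (undr qx) (undl xy) (undl xz)) => //;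
  [apply: nesym|apply: arcF px xy|apply: arcF px xz|apply: arcF qx xy|apply: arcF qx xz].
Qed.

Lemma clw_ins t : clw t -> exists a b c, [/\ o a t, o b t & o c t] /\
  [/\ a <> b, a <> c & b <> c].
Proof.
move=> ct; have : 2 < indeg o t by rewrite (eqP ct).
case/card_gt2P=> a [b [c [[]]]]; rewrite !inE => at_ bt ct_ [/eqP ab /eqP bc /eqP ca].
by exists a, b, c; split; split=> //; apply: nesym.
Qed.

Lemma clw_nsrc t : clw t -> ~~ src t.
Proof. by rewrite /source => /eqP->. Qed.

Lemma clw_outF t x : clw t -> o t x -> False.
Proof.
move=> ct tx; have [a [b [c [[at_ bt ct_] [ab ac bc]]]]] := clw_ins ct.
by case: (deg4F (undr at_) (undr bt) (undr ct_) (undl tx)) => //;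
  [apply: arcF at_ tx|apply: arcF bt tx|apply: arcF ct_ tx].
Qed.

Lemma clw_in a b c x t : clw t -> o a t -> o b t -> o c t -> a <> b -> a <> c -> b <> c ->
  o x t -> [\/ x = a, x = b | x = c].
Proof.
move=> ct at_ bt ct_ ab ac bc xt.
case: (x =P a) => [|xa]; first by constructor 1.
case: (x =P b) => [|xb]; first by constructor 2.
case: (x =P c) => [|xc]; first by constructor 3.
by case: (@deg4F t x a b c) => //; apply: undr.
Qed.

Lemma outs3 s x y z w : o s x -> o s y -> o s z -> x <> y -> x <> z -> y <> z ->
  o s w -> [\/ w = x, w = y | w = z].
Proof.
move=> sx sy sz xy xz yz sw.
case: (w =P x) => [|wx]; first by constructor 1.
case: (w =P y) => [|wy]; first by constructor 2.
case: (w =P z) => [|wz]; first by constructor 3.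
by case: (@deg4F s w x y z) => //; apply: undl.
Qed.

Lemma two_outs_src s x y : o s x -> o s y -> x <> y -> src s.
Proof. by move=> sx sy xy; apply/negPn/negP=> ns; apply: xy; apply: out_uniq ns sx sy. Qed.

(** Claw-freeness at [v] gives an edge among two in-neighbors [p], [q] and [w]. As [p] and [q] are
    centers, their only out-neighbor is [v], so this edge must leave [w]. *)
Lemma nsrc_triangle v w : ~~ src v -> o v w -> (forall u, o u v -> ~~ src u) ->
  exists2 g, o w g & o g v.
Proof.
move=> nv vw nin; have [p pv] := nsrc_ex nv; have [q qv qp] := other_in pv.
have pw : p <> w by apply: arcF pv vw.
have qw : q <> w by apply: arcF qv vw.
have np := nin _ pv; have nq := nin _ qv.
case: (so_cf so (undr pv) (undr qv) (undl vw)) => //; first exact: nesym.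
- case/orP=> h; first by have := irrF qv; rewrite (out_uniq np pv h).
  by have := irrF pv; rewrite (out_uniq nq qv h).
- case/orP=> h; last by exists p.
  by have := irrF vw; rewrite (out_uniq np pv h).
- case/orP=> h; last by exists q.
  by have := irrF vw; rewrite (out_uniq nq qv h).
Qed.

(** * Greedy coloring of the centers *)

Lemma conflict_sym x y : conflict o x y -> conflict o y x.
Proof.
case.
- by move=> s h1 h2 h3 h4; apply: (ConflictSrc h1 h3 h2); apply: nesym.
- exact: ConflictClawR.
- exact: ConflictClaw.
- exact: ConflictNsrcR.
- exact: ConflictNsrc.
Qed.

Lemma conflict_irr x y : conflict o x y -> x <> y.
Proof. by case=> // h _; [|apply/nesym| |apply/nesym]; apply: irrF h. Qed.

Lemma third_color (i j : 'I_3) : exists2 k : 'I_3, k <> i & k <> j.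
Proof.
have : 0 < #|~: [set i; j]|.
  by rewrite cardsCs setCK card_ord subn_gt0 cards2; case: (i != j).
by case/card_gt0P=> k; rewrite !inE negb_or => /andP[/eqP ? /eqP ?]; exists k.
Qed.

Lemma greedy_coloring (C : {set T}) :
  (forall S, S \subset C -> S != set0 -> exists2 c, c \in S & low o S c) ->
  exists col, proper_on o C col.
Proof.
move=> lowC.
suff: forall n (S : {set T}), #|S| <= n -> S \subset C -> exists col, proper_on o S col.
  by move=> /(_ _ _ (leqnn _) (subxx C)).
elim=> [|n IHn] S.
  rewrite leqn0 cards_eq0 => /eqP-> _.
  by exists (fun=> ord0); split=> x; rewrite inE.
move=> Sn SC; have [->|S0] := eqVneq S set0.
  by exists (fun=> ord0); split=> x; rewrite inE.
have [c cS [x [y [cf tr]]]] := lowC S SC S0.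
have [||col [pc pt]] := IHn (S :\ c).
- by move: Sn; rewrite (cardsD1 c) cS.
- by apply: subset_trans SC; apply: subsetDl.
have [k kx ky] := third_color (col x) (col y).
pose col' z := if z == c then k else col z.
have colc : col' c = k by rewrite /col' eqxx.
have coln z : z <> c -> col' z = col z by move=> /eqP/negbTE; rewrite /col' => ->.
have key z : z \in S -> conflict o c z -> col' z <> k.
  move=> zS h; rewrite coln; last by apply: nesym; apply: conflict_irr h.
  by case: (cf z zS h) => ->; apply: nesym.
have keyt e f : e \in S -> f \in S -> o c e -> o e f -> o f c ->
    ~ (col' e = k /\ col' f = k).
  move=> eS fS ce ef fc; rewrite !coln; [|exact: irrF fc|exact/nesym/(irrF ce)].
  by case: (tr e f eS fS ce ef fc) => -> [h1 h2]; [apply: kx|apply: ky|apply: kx|apply: ky].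
exists col'; split.
- move=> u v uS vS uv; have nuv := conflict_irr uv.
  case: (u =P c) => [e|uc]; first by subst u; rewrite colc; apply: nesym; apply: key.
  case: (v =P c) => [e|vc].
    by subst v; rewrite colc; apply: key => //; apply: conflict_sym.
  rewrite !coln //; apply: pc => //; rewrite !inE ?uS ?vS andbT; exact/eqP.
- move=> u v w uS vS wS uv vw wu [e1 e2].
  case: (u =P c) => [e|uc].
    by subst u; apply: (keyt v w) => //; rewrite -e2 -e1 colc.
  case: (v =P c) => [e|vc].
    by subst v; apply: (keyt w u) => //; rewrite -e2 e1 colc.
  case: (w =P c) => [e|wc].
    by subst w; apply: (keyt u v) => //; rewrite e1 e2 colc.
  move: e1 e2; rewrite !coln // => e1 e2.
  by apply: (pt u v w) => //; rewrite !inE ?uS ?vS ?wS andbT; exact/eqP.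
Qed.

(** A source that is not full costs each of its out-neighbors at most one color. *)
Lemma partner S s c : src s -> o s c -> c \in S ->
  (exists x, forall z, z \in S -> z <> c -> o s z -> z = x) \/ full o S s.
Proof.
move=> ss sc cS; case: (classic (full o S s)) => [|nf]; [by right|left].
case: (pickP [pred z | [&& z \in S, z != c & o s z]]) => [x /and3P[xS /eqP xc sx]|none].
  exists x => z zS zc sz; case: (z =P x) => // zx; case: nf.
  by exists c, x, z; do !split=> //; apply: nesym.
(* No such vertex exists, so [c] only fills the place. *)
exists c => z zS zc sz; have := none z.
by rewrite /= zS sz (introN eqP zc).
Qed.

Lemma third_out s p q : o s p -> o s q -> p <> q ->
  exists w, forall z, o s z -> [\/ z = p, z = q | z = w].
Proof.
move=> sp sq pq.
case: (pickP [pred z | [&& z != p, z != q & o s z]]) => [w /and3P[/eqP wp /eqP wq sw]|none].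
  by exists w => z sz; apply: (outs3 sp sq sw) => //; apply: nesym.
exists p => z sz; have := none z; rewrite /= sz andbT.
by case: (z =P p) => [->|_]; [constructor 1|case: (z =P q) => [->|//]; constructor 2].
Qed.

Lemma full_src S s : full o S s -> src s.
Proof. by case=> x [y [z [_ [_ []]]]]. Qed.

Lemma full_third S s p q : full o S s -> o s p -> o s q -> p <> q ->
  [/\ p \in S, q \in S & exists w, [/\ w \in S, o s w, w <> p & w <> q]].
Proof.
case=> x [y [z [[xS yS zS] [[sx sy sz] [_ xy xz yz]]]]] sp sq pq.
have hp := outs3 sx sy sz xy xz yz sp; have hq := outs3 sx sy sz xy xz yz sq.
case: hp pq => -> pq; case: hq pq => -> pq //; split=> //.
- by exists z; split=> //; apply: nesym.
- by exists y; split=> //; apply: nesym.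
- by exists z; split=> //; apply: nesym.
- by exists x; split=> //; apply: nesym.
- by exists y; split=> //; apply: nesym.
- by exists x; split=> //; apply: nesym.
Qed.

(** * Low vertices and the obstacles to them *)

Section LowVertex.
Variable S : {set T}.
Hypothesis Sn : forall z, z \in S -> ~~ src z.

Lemma memS_srcF z : z \in S -> src z -> False.
Proof. by move=> /Sn/negP. Qed.

(** A center [c] that is not a claw center has exactly two in-neighbors; each of them that is a
    source short of full contributes one vertex to avoid. The three cases count the sources among
    the two. *)
Lemma low_or_full c : c \in S -> ~~ clw c -> (forall t, o c t -> ~~ clw t) ->
  low o S c \/ exists2 s, o s c & full o S s.
Proof.
move=> cS nc no.
case: (classic (exists2 s, o s c & full o S s)) => [|nf]; [by right|left].
have part s : src s -> o s c -> exists x, forall z, z \in S -> z <> c -> o s z -> z = x.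
  by move=> ss sc; case: (partner ss sc cS) => // f; case: nf; exists s.
(* One vertex to avoid is the partner of [c] at the source [p], the other is the center [q]
   itself. *)
have mixed p q : o p c -> o q c -> q <> p -> src p -> ~~ src q -> low o S c.
  move=> pc qc qp sp nq; have ins r := @ins2 p q r c nc pc qc (nesym qp).
  have [x hx] := part p sp pc; exists x, q; split.
  - move=> z zS [s ss sc sz cz|cz clz|zc clc|cz nin|zc nin].
    + case: (ins s sc) ss sz => -> ss sz; last by rewrite ss in nq.
      by left; apply: hx => //; apply: nesym.
    + by have := no z cz; rewrite clz.
    + by rewrite clc in nc.
    + by have := nin p pc; rewrite sp.
    + by case: (ins z zc) zS => [->|->] zS; [case: (memS_srcF zS sp)|right].
  - move=> e f eS fS ce ef fc; case: (ins f fc) fS => -> fS; first by case: (memS_srcF fS sp).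
    by constructor 4.
have [p pc] := nsrc_ex (Sn cS); have [q qc qp] := other_in pc.
have ins r := @ins2 p q r c nc pc qc (nesym qp).
case: (boolP (src p)) => sp; case: (boolP (src q)) => sq.
- have [x hx] := part p sp pc; have [y hy] := part q sq qc; exists x, y; split.
  + move=> z zS [s ss sc sz cz|cz clz|zc clc|cz nin|zc nin].
    * case: (ins s sc) ss sz => -> ss sz; [left; apply: hx|right; apply: hy] => //;
        exact: nesym.
    * by have := no z cz; rewrite clz.
    * by rewrite clc in nc.
    * by have := nin p pc; rewrite sp.
    * by case: (ins z zc) zS => -> zS; [case: (memS_srcF zS sp)|case: (memS_srcF zS sq)].
  + move=> e f eS fS ce ef fc.
    by case: (ins f fc) fS => -> fS; [case: (memS_srcF fS sp)|case: (memS_srcF fS sq)].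
- exact: (mixed p q).
- by apply: (mixed q p) => //; apply: nesym.
have nin u : o u c -> ~~ src u by move=> /ins[] ->.
case: (classic (exists w, o c w)) => [[w cw]|noout].
(* Only the successor [w] and the predecessor [g] of [c] on a directed triangle matter: a conflict
   through an arc [z -> c] puts [z] on a triangle through [c -> w], so [z] is the unique
   out-neighbor [g] of [w]. *)
- have [g wg gc] := nsrc_triangle (Sn cS) cw nin; exists w, g; split.
  + move=> z zS [s ss sc sz cz|cz clz|zc clc|cz _|zc ninz].
    * by have := nin s sc; rewrite ss.
    * by have := no z cz; rewrite clz.
    * by rewrite clc in nc.
    * by left; apply: out_uniq (Sn cS) cz cw.
    * have [g' cg' g'z] := nsrc_triangle (Sn zS) zc ninz.
      rewrite (out_uniq (Sn cS) cg' cw) in g'z.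
      by right; apply: out_uniq (nsrc_in cw) g'z wg.
  + by move=> e f eS fS ce ef fc; constructor 1; apply: out_uniq (Sn cS) ce cw.
- exists p, q; split; last by move=> e f _ _ ce; case: noout; exists e.
  move=> z zS [s ss sc sz cz|cz clz|zc clc|cz _|zc ninz].
  + by have := nin s sc; rewrite ss.
  + by case: noout; exists z.
  + by rewrite clc in nc.
  + by case: noout; exists z.
  + exact: ins.
Qed.

Lemma full_triangle s : full o S s -> exists v1 v2 v3,
  [/\ v1 \in S, v2 \in S & v3 \in S] /\ [/\ o s v1, o s v2 & o s v3] /\
  [/\ v1 <> v2, v1 <> v3, v2 <> v3 & o v1 v2].
Proof.
case=> x [y [z [[xS yS zS] [[sx sy sz] [_ xy xz yz]]]]].
have yx := nesym xy; have zx := nesym xz; have zy := nesym yz.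
case: (so_cf so (undl sx) (undl sy) (undl sz) xy xz yz) => /orP[] h;
  by [exists x, y, z|exists y, x, z|exists x, z, y|exists z, x, y|exists y, z, x|exists z, y, x].
Qed.

Lemma low_triangle s v1 v2 v3 : src s -> o s v1 -> o s v2 -> o s v3 ->
  v1 <> v2 -> v1 <> v3 -> v2 <> v3 -> o v1 v2 -> ~~ clw v2 ->
  (forall t, o v2 t -> ~~ clw t) -> low o S v2.
Proof.
move=> ss s1 s2 s3 n12 n13 n23 v12 nc no; have ns1 := nsrc_in s1.
have ins r := @ins2 s v1 r v2 nc s2 v12 (irrF s1).
exists v1, v3; split.
- move=> z zS [s' ss' s'2 s'z cz|cz clz|zc clc|cz nin|zc nin].
  + case: (ins _ s'2) ss' s'z => -> ss' s'z; last by rewrite ss' in ns1.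
    by case: (outs3 s1 s2 s3 n12 n13 n23 s'z) => e; [left|case: cz|right].
  + by have := no z cz; rewrite clz.
  + by rewrite clc in nc.
  + by have := nin s s2; rewrite ss.
  + by case: (ins z zc) zS => -> zS; [case: (memS_srcF zS ss)|left].
- move=> e f eS fS ce ef fc; case: (ins f fc) fS => -> fS; first by case: (memS_srcF fS ss).
  by constructor 3.
Qed.

(** Avoiding [x] and [y] already meets every constraint that the source [u] puts on [v]. If [v] is
    still not low, something else must bind it: another source, an in-arc of [ConflictNsrcR], or a
    directed triangle. *)
Lemma low_or_escape u v x y : v \in S -> src u -> o u v ->
  (forall z, z \in S -> o u z -> [\/ z = v, z = x | z = y]) ->
  ~~ clw v -> (forall t, o v t -> ~~ clw t) ->
  low o S v \/ exists z, [/\ z \in S, z <> v, z <> x & z <> y] /\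
    [\/ exists s, [/\ src s, s <> u, o s v & o s z],
        o z v /\ (forall w, o w z -> ~~ src w)
      | exists e, [/\ e \in S, e <> x, e <> y, o v e & o e z /\ o z v]].
Proof.
move=> vS su uv outs nc no.
match goal with |- _ \/ ?E => case: (classic E) => [|N]; first by right end; left.
exists x, y; split.
- move=> z zS [s ss sv sz vz|vz clz|zv clc|vz nin|zv nin].
  + case: (s =P u) sz => [->|su'] sz.
      by case: (outs z zS sz) => e; [case: vz|left|right].
    case: (z =P x) => [|zx]; first by left.
    case: (z =P y) => [|zy]; first by right.
    case: N; exists z; split; first by split=> //; apply: nesym.
    by constructor 1; exists s.
  + by have := no z vz; rewrite clz.
  + by rewrite clc in nc.
  + by have := nin u uv; rewrite su.
  + case: (z =P x) => [|zx]; first by left.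
    case: (z =P y) => [|zy]; first by right.
    case: N; exists z; split; first by split=> //; apply: irrF zv.
    by constructor 2.
- move=> e f eS fS ve ef fv.
  case: (e =P x) => [|ex]; first by constructor 1.
  case: (e =P y) => [|ey]; first by constructor 2.
  case: (f =P x) => [|fx]; first by constructor 3.
  case: (f =P y) => [|fy]; first by constructor 4.
  case: N; exists f; split; first by split=> //; apply: irrF fv.
  by constructor 3; exists e.
Qed.

(** The claw center [t] has no out-arc, so [c -> t] lies on no directed triangle; by [nsrc_triangle]
    this excludes a conflict through an in-arc of [c]. *)
Lemma conflict_to_claw c t z : c \in S -> o c t -> clw t -> z \in S -> conflict o c z ->
  z = t \/ exists s, [/\ src s, o s c, o s z & z <> c].
Proof.
move=> cS ct clt zS [s ss sc sz cz|cz clz|zc clc|cz nin|zc nin].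
- by right; exists s; split=> //; apply: nesym.
- by left; apply: out_uniq (Sn cS) cz ct.
- by case: (clw_outF clc ct).
- by left; apply: out_uniq (Sn cS) cz ct.
- have [g cg gz] := nsrc_triangle (Sn zS) zc nin.
  by rewrite (out_uniq (Sn cS) cg ct) in gz; case: (clw_outF clt gz).
Qed.

Hypothesis NL : forall c, c \in S -> ~ low o S c.

Lemma full_claw s : full o S s -> exists v1 v2 v3,
  [/\ v1 \in S, v2 \in S & v3 \in S] /\ [/\ o s v1, o s v2 & o s v3] /\
  [/\ v1 <> v2, v1 <> v3, v2 <> v3 & o v1 v2] /\
  (clw v2 \/ exists2 t, o v2 t & clw t).
Proof.
move=> fs; have ss := full_src fs.
have [v1 [v2 [v3 [[? S2 ?] [[? ? ?] [? ? ? ?]]]]]] := full_triangle fs.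
exists v1, v2, v3; do 3!split=> //.
case: (boolP (clw v2)) => c2; [by left|right]; apply: NNPP => nt; apply: (NL S2).
apply: (@low_triangle s v1 v2 v3) => // t v2t; apply/negP => ct.
by apply: nt; exists t.
Qed.

End LowVertex.

Lemma low_without_claw S : (forall x, ~~ clw x) -> (forall z, z \in S -> ~~ src z) ->
  S != set0 -> exists2 c, c \in S & low o S c.
Proof.
move=> noc Sn /set0Pn[c cS]; apply: NNPP => N.
have NL z : z \in S -> ~ low o S z by move=> zS lz; apply: N; exists z.
case: (low_or_full Sn cS (noc c) (fun t _ => noc t)) => [/(NL c cS)//|[s _ fs]].
have [v1 [v2 [v3 [_ [_ [_ [c2|[t _ ct]]]]]]]] := full_claw Sn NL fs.
- by have := noc v2; rewrite c2.
- by have := noc t; rewrite ct.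
Qed.

(** * Sets of centers without a low member when there is exactly one claw center *)

Section UniqueClaw.
Variables t a b d : T.
Hypotheses (ct : clw t) (uct : forall x, clw x -> x = t).
Hypotheses (at_ : o a t) (bt : o b t) (dt : o d t) (ab' : a <> b) (ad' : a <> d) (bd' : b <> d).
Hypothesis (ab : o a b).

Lemma in_t x : o x t -> [\/ x = a, x = b | x = d].
Proof. exact: clw_in. Qed.

Lemma src_a : src a.
Proof. by apply: (two_outs_src at_ ab); apply/nesym/(irrF bt). Qed.

Lemma nsrc_b : ~~ src b.
Proof. exact: nsrc_in ab. Qed.

Lemma nclw x : x <> t -> ~~ clw x.
Proof. by move=> xt; apply/negP=> /uct. Qed.

Lemma to_claw x y : o x y -> clw y -> o x t.
Proof. by move=> xy /uct<-. Qed.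

Lemma nclw_b : ~~ clw b.
Proof. by apply: nclw; apply: irrF bt. Qed.

Variable S : {set T}.
Hypotheses (Sn : forall z, z \in S -> ~~ src z) (S0 : S != set0).
Hypothesis NL : forall c, c \in S -> ~ low o S c.

Lemma a_notin : a \in S -> False.
Proof. by move=> aS; apply: (memS_srcF Sn aS); apply: src_a. Qed.

Lemma reach_full z : z \in S -> z <> t -> ~ o z t -> exists2 s, o s z & full o S s.
Proof.
move=> zS zt nzt; case: (low_or_full Sn zS (nclw zt)) => // [y zy|/(NL zS)//].
by apply/negP=> /(to_claw zy).
Qed.

Lemma neq_t_in : exists2 c, c \in S & c <> t.
Proof.
apply: NNPP => N; have St z : z \in S -> z = t.
  by move=> zS; apply: NNPP => zt; apply: N; exists z.
have [c cS] := set0Pn _ S0; apply: (NL cS); exists t, t; split.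
- by move=> z /St; left.
- by move=> e f /St; constructor 1.
Qed.

Lemma escape_claw u v x y : v \in S -> src u -> o u v ->
  (forall z, o u z -> [\/ z = v, z = x | z = y]) -> v <> t -> ~ o v t ->
  exists z, [/\ z \in S, z <> v, z <> x & z <> y] /\
    [\/ exists s, [/\ src s, s <> u, o s v & o s z],
        o z v /\ (forall w, o w z -> ~~ src w)
      | exists e, [/\ e \in S, e <> x, e <> y, o v e & o e z /\ o z v]].
Proof.
move=> vS su uv outs vt nvt.
case: (low_or_escape (x := x) (y := y) vS su uv _ (nclw vt)) => //.
- by move=> z _; apply: outs.
- by move=> w vw; apply/negP=> /(to_claw vw).
- by move=> /(NL vS).
Qed.

(** The only possible full source is [a], and it is full, for otherwise [S] lies within [t] and [b].
    Its third out-neighbor [w] must escape to a vertex below a full source, hence to an out-neighbor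
    of [a] other than [w], [t], [b]; there is none. *)
Lemma claw_src_absurd : src d -> ~~ o d b -> False.
Proof.
move=> sd ndb.
have d_notin z : z \in S -> z <> d by move=> zS zd; apply: (memS_srcF Sn zS); rewrite zd.
have a_notin' z : z \in S -> z <> a by move=> zS za; apply: a_notin; rewrite -za.
have bto z : z \in S -> o z t -> z = b.
  by move=> zS /in_t[] // zE; [case: (a_notin' z)|case: (d_notin z)].
have [b' b'b b'a] := other_in ab.
have insb x := @ins2 a b' x b nclw_b ab b'b (nesym b'a).
have full_a s : full o S s -> s = a.
  move=> fs; have ss := full_src fs.
  have [v1 [v2 [v3 [[S1 S2 S3] [[s1 s2 s3] [[n12 n13 n23 v12] ]]]]]] := full_claw Sn NL fs.
  case=> [/uct e|[y v2y /(to_claw v2y) v2t]].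
    subst v2; case: (in_t s2) => // e; subst s.
      by have := nsrc_b; rewrite ss.
    by rewrite (bto v1 S1 v12) in s1; rewrite s1 in ndb.
  have e := bto v2 S2 v2t; subst v2.
  case: (insb s s2) => // e; subst s.
  case: (insb v1 v12) => e; subst v1; first by case: a_notin.
  by case: (irrF s1).
have fa : full o S a.
  apply: NNPP => nfa; have [c cS c_t] := neq_t_in.
  have nz z : z \in S -> z <> t -> z = b.
    move=> zS zt; case: (boolP (o z t)) => [/(bto z zS)//|/negP zt'].
    by have [s sz fs] := reach_full zS zt zt'; case: nfa; rewrite -(full_a s fs).
  apply: (NL cS); exists t, b; split.
    by move=> z zS _; case: (z =P t) => [|/(nz z zS)]; [left|right].
  by move=> e f eS _ _ _ _; case: (e =P t) => [|/(nz e eS)]; [constructor 1|constructor 2].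
have [tS bS [w [wS aw wt wb]]] := full_third fa at_ ab (nesym (irrF bt)).
have outa z := @outs3 a w t b z aw at_ ab wt wb (nesym (irrF bt)).
have nwt : ~ o w t by move=> /(bto w wS).
have [z [[zS zw zt zb] _]] := escape_claw wS src_a aw outa wt nwt.
have nzt : ~ o z t by move=> /(bto z zS).
have [s sz fs] := reach_full zS zt nzt.
by rewrite (full_a s fs) in sz; case: (outa z sz).
Qed.

(** In [S], [b] would be low, so [a] is not full. Every full source then points to [d], and the
    in-neighbors of [d] leave only one such source [u]. The two other out-neighbors of [u] can
    escape only to [t], which makes both of them out-neighbors of [a]; with [t] and [b] this gives
    [a] degree four. *)
Lemma claw_nsrc_absurd : ~~ src d -> (forall x, o x b -> x <> a -> ~~ src x) -> False.
Proof.
move=> nd nb.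
have tb : t <> b by apply/nesym/(irrF bt).
have nS : b \in S -> False.
  move=> bS; apply: (NL bS); have [w hw] := third_out at_ ab tb; exists t, w; split.
  - move=> z zS /(conflict_to_claw Sn bS bt ct zS)[|[s [ss sb sz zb]]]; first by left.
    case: (s =P a) sz => [->|sa] sz; last by have := nb s sb sa; rewrite ss.
    by case: (hw z sz) => //; [left|right].
  - by move=> e f eS fS be ef _; rewrite (out_uniq nsrc_b be bt) in ef; case: (clw_outF ct ef).
have nfa : ~ full o S a by move=> /full_third /(_ at_ ab tb)[].
have bto z : z \in S -> o z t -> z = d.
  move=> zS /in_t[] // zE; subst z; [by case: a_notin|by case: nS].
have src_t s : src s -> o s t -> s = a.
  by move=> ss /in_t[] // e; subst s; [have := nsrc_b|]; rewrite ss in nd *.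
have fullE u : full o S u -> exists v1 v3, [/\ v1 \in S, d \in S & v3 \in S] /\
    [/\ o u v1, o u d & o u v3] /\ [/\ v1 <> d, v1 <> v3, d <> v3 & o v1 d].
  move=> fu; have su := full_src fu.
  have [v1 [v2 [v3 [[S1 S2 S3] [[s1 s2 s3] [[n12 n13 n23 v12] ]]]]]] := full_claw Sn NL fu.
  case=> [/uct e|[y v2y /(to_claw v2y) v2t]].
    by subst v2; case: nfa; rewrite -(src_t u su s2).
  by have e := bto v2 S2 v2t; subst v2; exists v1, v3.
have [u fu] : exists u, full o S u.
  apply: NNPP => nf.
  have Std z : z \in S -> z = t \/ z = d.
    move=> zS; case: (z =P t) => [|zt]; [by left|right].
    case: (boolP (o z t)) => [/(bto z zS)//|/negP zt'].
    by have [s sz fs] := reach_full zS zt zt'; case: nf; exists s.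
  have [c cS] := set0Pn _ S0; apply: (NL cS); exists t, d; split.
    by move=> z /Std.
  by move=> e f /Std[]; [constructor 1|constructor 2].
have su := full_src fu.
have [v1 [v3 [[S1 Sd S3] [[u1 ud u3] [n1d n13 nd3 v1d]]]]] := fullE u fu.
have nut : ~ o u t by move=> /(src_t u su) ua; apply: nfa; rewrite -ua.
have uniqf s : full o S s -> s = u.
  move=> fs; have [w1 [w3 [_ [[_ sd _] _]]]] := fullE s fs.
  case: (@ins2 u v1 s d _ ud v1d (irrF u1) sd) => // [|e].
    by apply: nclw; apply: irrF dt.
  by case: (memS_srcF Sn S1); rewrite -e; apply: full_src fs.
(* Any vertex other than [t] to which [v] escapes would be below the full source [u], whose
   out-neighbors are exhausted. The escape to [t] has to go through a source pointing to [t], that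
   is [a]. *)
have key v x : v \in S -> o u v -> o u x -> v <> d -> x <> d -> v <> x -> o a v.
  move=> vS uv ux vd xd vx.
  have vt : v <> t by move=> e; apply: nut; rewrite -e.
  have outs z := @outs3 u v x d z uv ux ud vx vd xd.
  have nvt : ~ o v t by move=> /(bto v vS).
  have [z [[zS zv zx zd] E]] := escape_claw vS su uv outs vt nvt.
  case: (z =P t) => [e|zt].
    subst z; case: E => [[s [ss _ sv st]]|[tv _]|[e [_ _ _ _ [_ tv]]]].
    + by rewrite -(src_t s ss st).
    + by case: (clw_outF ct tv).
    + by case: (clw_outF ct tv).
  have nzt : ~ o z t by move=> /(bto z zS).
  have [s sz fs] := reach_full zS zt nzt.
  by rewrite (uniqf s fs) in sz; case: (outs z sz).
have a1 := key v1 v3 S1 u1 u3 n1d (nesym nd3) n13.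
have a3 := key v3 v1 S3 u3 u1 (nesym nd3) n1d (nesym n13).
have neq v : v \in S -> o u v -> t <> v /\ b <> v.
  by move=> vS uv; split=> e; subst v; [apply: nut|apply: nS].
have [t1 b1] := neq v1 S1 u1; have [t3 b3] := neq v3 S3 u3.
exact: (deg4F (undl at_) (undl ab) (undl a1) (undl a3)).
Qed.

(** Here [a], [b], [d], [t] span a diamond, and the outcome is a configuration to be rotated, not a
    contradiction. The only candidates for full sources are [a] and [d]. As [b] is not low, their
    third out-neighbors [w] and [w'] are distinct members of [S]; then [w] can escape only to [w'],
    through another source [s]. *)
Lemma claw_diamond_cycle : src d -> o d b -> exists w w' s,
  [/\ o a w, o d w', src s, o s w & o s w'] /\
  [/\ w <> w', w <> t, w <> b, w' <> t & w' <> b].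
Proof.
move=> sd db; have tb : t <> b by apply/nesym/(irrF bt).
have insb x := @ins2 a d x b nclw_b ab db ad'.
have a_notin' z : z \in S -> z <> a by move=> zS za; apply: a_notin; rewrite -za.
have d_notin z : z \in S -> z <> d by move=> zS zd; apply: (memS_srcF Sn zS); rewrite zd.
have bto z : z \in S -> o z t -> z = b.
  by move=> zS /in_t[] // zE; [case: (a_notin' z)|case: (d_notin z)].
have full_ad s : full o S s -> s = a \/ s = d.
  move=> fs; have ss := full_src fs.
  have [v1 [v2 [v3 [[S1 S2 S3] [[s1 s2 s3] [[n12 n13 n23 v12] ]]]]]] := full_claw Sn NL fs.
  case=> [/uct e|[y v2y /(to_claw v2y) v2t]].
    by subst v2; case: (in_t s2) => e; [left| |right] => //; have := nsrc_b; rewrite -e ss.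
  by have e := bto v2 S2 v2t; subst v2; apply: insb.
have bS : b \in S.
  have [c cS c_t] := neq_t_in.
  case: (boolP (o c t)) => [/(bto c cS) <-//|/negP nct].
  have [s sc fs] := reach_full cS c_t nct.
  by case: (full_ad s fs) (fs) => -> fs';
    [case: (full_third fs' at_ ab tb)|case: (full_third fs' dt db tb)].
have [w hw] := third_out at_ ab tb; have [w' hw'] := third_out dt db tb.
(* The only possible conflicts of [b] inside [S] are with [t], [w] and [w']. If one of them drops
   out or two coincide, [b] is low. *)
have lowb x y :
    (forall z, z \in S -> z <> b -> [\/ z = t, o a z /\ z = w | o d z /\ z = w'] -> z = x \/ z = y) -> False.
  move=> h; apply: (NL bS); exists x, y; split.
  - move=> z zS cbz; have zb := nesym (conflict_irr cbz).
    case: (conflict_to_claw Sn bS bt ct zS cbz) => [zt|[s [ss sb sz _]]].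
      by apply: h => //; constructor 1.
    apply: h => //; case: (insb s sb) sz => -> sz.
      by case: (hw z sz) => //; [constructor 1|constructor 2].
    by case: (hw' z sz) => //; [constructor 1|constructor 3].
  - by move=> e f eS fS be ef _; rewrite (out_uniq nsrc_b be bt) in ef; case: (clw_outF ct ef).
have [wS aw wt wb] : [/\ w \in S, o a w, w <> t & w <> b].
  apply: NNPP => N; apply: (lowb t w') => z zS zb [->|[az e]|[_ ->]]; [by left| |by right].
  by left; apply: NNPP => zt; apply: N; rewrite -e.
have [wS' dw' wt' wb'] : [/\ w' \in S, o d w', w' <> t & w' <> b].
  apply: NNPP => N; apply: (lowb t w) => z zS zb [->|[_ ->]|[dz e]]; [by left|by right| ].
  by left; apply: NNPP => zt; apply: N; rewrite -e.
have ww' : w <> w'.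
  by move=> e; apply: (lowb t w) => z zS zb [->|[_ ->]|[_ ->]]; [left|right|right].
have outa z : o a z -> [\/ z = w, z = t | z = b].
  by move=> /hw[]; [constructor 2|constructor 3|constructor 1].
have nwt : ~ o w t by move=> /(bto w wS).
have esc z : z \in S -> z <> t -> z <> b -> z = w \/ z = w'.
  move=> zS zt zb; have nzt : ~ o z t by move=> /(bto z zS).
  have [s sz fs] := reach_full zS zt nzt.
  by case: (full_ad s fs) sz => -> sz; [case: (hw z sz)|case: (hw' z sz)] => //; [left|right].
have [z [[zS zw zt zb] E]] := escape_claw wS src_a aw outa wt nwt.
have e : z = w' by case: (esc z zS zt zb).
subst z; case: E => [[s [ss sa sw sw']]|[_ nin]|[e [eS et eb we [ew' w'w]]]].
- by exists w, w', s.
- by have := nin d dw'; rewrite sd.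
- by case: (esc e eS et eb) => h; subst e; [case: (irrF we)|case: (irrF ew')].
Qed.

End UniqueClaw.

(** * From a coloring of the centers to a locally irregular edge-coloring *)

Lemma indeg_le3 x : indeg o x <= 3.
Proof.
apply: leq_trans (so_deg so x); apply/subset_leq_card/subsetP=> u.
by rewrite !inE => /undr.
Qed.

Lemma indeg2 x : ~~ src x -> ~~ clw x -> indeg o x = 2.
Proof.
have := indeg_le3 x; have := so_in so x; rewrite /source /claw_center.
by case: (indeg o x) => [|[|[|[|]]]].
Qed.

Definition centers := [set x | ~~ src x].

Lemma coloring_of_low :
  (forall S, (forall z, z \in S -> ~~ src z) -> S != set0 ->
     (forall c, c \in S -> ~ low o S c) -> False) ->
  exists col, proper_on o centers col.
Proof.
move=> h; apply: greedy_coloring => S /subsetP SC S0; apply: NNPP => N.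
apply: (h S) => // [z /SC|c cS lc]; first by rewrite inE.
by apply: N; exists c.
Qed.

(** The favorable configuration, to which [swap_claw] and [rotate_diamond] reduce by moving the claw
    center. *)
Lemma coloring_claw_src t a b d : clw t -> (forall x, clw x -> x = t) ->
  o a t -> o b t -> o d t -> a <> b -> a <> d -> b <> d -> o a b ->
  src d -> ~~ o d b -> exists col, proper_on o centers col.
Proof. by move=> *; apply: coloring_of_low => S *; apply: (@claw_src_absurd t a b d _ _ _ _ _ _ _ _ _ S). Qed.

(** If all in-neighbors of [v] are centers, [v] and [w] conflict. Otherwise take a source [s -> v]
    and an edge among [s], [u], [w]: an edge at [s] yields a source conflict, and an edge between
    [u] and [w] must be [w -> u], as [u] has one out-arc, which closes a directed triangle. *)
Lemma proper_path col u v w : proper_on o centers col -> ~~ src u -> o u v -> o v w ->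
  col u = col v -> col v = col w -> False.
Proof.
case=> pc pt nu uv vw e1 e2.
have nv := nsrc_in uv; have nw := nsrc_in vw.
have inC x : ~~ src x -> x \in centers by rewrite inE.
case: (classic (forall x, o x v -> ~~ src x)) => [nin|].
  by apply: (pc v w) => //; try exact: inC; apply: ConflictNsrc.
case/not_all_ex_not=> s /(imply_to_and (o s v)) [sv /negP/negPn ss].
have su : s <> u by move=> e; rewrite -e ss in nu.
case: (so_cf so (undr sv) (undr uv) (undl vw)) => //; [exact: arcF sv vw|exact: arcF uv vw|..].
- case/orP=> h; last by case: (srcF ss h).
  by apply: (pc u v) => //; try exact: inC; apply: (ConflictSrc ss h sv (irrF uv)).
- case/orP=> h; last by case: (srcF ss h).
  by apply: (pc v w) => //; try exact: inC; apply: (ConflictSrc ss sv h (irrF vw)).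
- case/orP=> h; first by case: (irrF vw); apply: out_uniq nu uv h.
  by apply: (pt u v w) => //; exact: inC.
Qed.

Definition arc_color (col : T -> 'I_3) x y := if o x y then col y else col x.

Lemma arc_color_sym col x y : und o x y -> arc_color col x y = arc_color col y x.
Proof.
rewrite /arc_color; case/orP=> h; rewrite h.
- by rewrite (negbTE (so_asym so h)).
- by rewrite (negbTE (so_asym so h)).
Qed.

Lemma card_arc_color col x i :
  #|[set z | und o x z && (arc_color col x z == i)]| =
  (col x == i) * indeg o x + #|[set z | o x z && (col z == i)]|.
Proof.
have -> : [set z | und o x z && (arc_color col x z == i)] =
    [set z | o z x && (col x == i)] :|: [set z | o x z && (col z == i)].
  apply/setP=> z; rewrite !inE /und /arc_color.
  case: (boolP (o x z)) => xz /=; first by rewrite (negbTE (so_asym so xz)).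
  by rewrite orbF.
rewrite cardsU (_ : _ :&: _ = set0) ?cards0 ?subn0; last first.
  apply/setP=> z; rewrite !inE; apply/negP=> /andP[/andP[zx _] /andP[xz _]].
  exact: asymF zx xz.
congr (_ + _); case: (col x == i); last by rewrite mul0n eq_card0 // => z; rewrite !inE andbF.
by rewrite mul1n; apply: eq_card => z; rewrite !inE andbT.
Qed.

(** In the color of [y], the vertex [y] has at least its two or three in-arcs. If [x] is a source or
    has another color, it has one such edge. If [x] is a center of the same color, it has 2 + 1 and
    [y] has exactly 2, since [y] is not a claw center and [proper_path] excludes an out-arc of that
    color. *)
Lemma arc_color_irregular col x y : proper_on o centers col -> o x y ->
  #|[set z | und o x z && (arc_color col x z == col y)]| !=
  #|[set z | und o y z && (arc_color col y z == col y)]|.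
Proof.
move=> pcol xy; have [pc pt] := pcol; rewrite !card_arc_color eqxx mul1n.
have ny := nsrc_in xy; have iy : 1 < indeg o y.
  by have := so_in so y; move: ny; rewrite /source; case: (indeg o y) => [|[]].
have ge1 : 0 < #|[set z | o x z && (col z == col y)]|.
  by apply/card_gt0P; exists y; rewrite inE xy eqxx.
have le1 : #|[set z | o x z && (col z == col y)]| <= 1.
  apply/card_le1_eqP => z z'; rewrite !inE => /andP[xz /eqP cz] /andP[xz' /eqP cz'].
  case: (boolP (src x)) => sx; last exact: out_uniq sx xz' xz.
  case: (z' =P z) => // nz; case: (pc z' z); rewrite ?inE ?(nsrc_in xz) ?(nsrc_in xz') //.
    exact: (ConflictSrc sx xz' xz).
  by rewrite cz cz'.
have -> : #|[set z | o x z && (col z == col y)]| = 1 by apply/eqP; rewrite eqn_leq le1.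
have lt1 : 1 < indeg o y + #|[set z | o y z && (col z == col y)]| by apply: ltn_addr.
case: (boolP (src x)) => sx.
  by rewrite (eqP sx) muln0 add0n neq_ltn lt1.
case: (col x =P col y) => [cxy|_]; last by rewrite neq_ltn lt1.
have cx : ~~ clw x by apply/negP => /clw_outF/(_ xy).
have cy : ~~ clw y.
  apply/negP => cy; apply: (pc x y); rewrite ?inE // ; exact: ConflictClaw.
rewrite (indeg2 sx cx) (indeg2 ny cy) eq_card0 // => z; rewrite !inE.
apply/negP=> /andP[yz /eqP cz]; exact: (proper_path pcol sx xy yz).
Qed.

End Orientation.

(** * Reversing edges and pairing off the claw centers *)

Section Flip.
Variable T : finType.
Implicit Types o : rel T.

Definition flip o u v : rel T := fun x y =>
  if (x == u) && (y == v) || (x == v) && (y == u) then o y x else o x y.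

Definition asym o := forall x y, o x y -> ~~ o y x.

Lemma und_flip o u v : und (flip o u v) =2 und o.
Proof.
move=> x y; rewrite /und /flip ![(y == _) && _]andbC [X in if X then o x y else _]orbC.
by case: ifP => _ //; rewrite orbC.
Qed.

Lemma asym_flip o u v : asym o -> asym (flip o u v).
Proof.
move=> ao x y; rewrite /flip ![(y == _) && _]andbC [X in if X then o x y else _]orbC.
by case: ifP => _; apply: ao.
Qed.

Lemma flipC o u v : flip o u v =2 flip o v u.
Proof. by move=> x y; rewrite /flip orbC. Qed.

Lemma eq_indeg o o' x : o =2 o' -> indeg o x = indeg o' x.
Proof. by move=> e; apply: eq_card => u; rewrite !inE e. Qed.

Lemma indeg_flip o u v x : asym o -> o u v ->
  indeg (flip o u v) x + (x == v) = indeg o x + (x == u).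
Proof.
move=> ao uv; have vu := negbTE (ao _ _ uv).
have nuv : u != v by apply: contraTneq uv => ->; apply/negP=> h; move: (ao _ _ h); rewrite h.
have nvu : v != u by rewrite eq_sym.
case: (eqVneq x v) => [->|xv].
  rewrite (negbTE nvu) addn0 /indeg (cardsD1 u [set w | o w v]) inE uv addnC; congr (_ + _).
  apply: eq_card => w; rewrite !inE /flip (negbTE nvu) andbF orbF eqxx andbT.
  by case: (eqVneq w u) => [->|].
case: (eqVneq x u) => [->|xu].
  rewrite addn0 addnC /indeg (cardsD1 v) inE /flip (negbTE nvu) !eqxx uv /=; congr (_ + _).
  apply: eq_card => w; rewrite !inE; case: (eqVneq w v) => [->|wv] /=; first by rewrite vu.
  by rewrite (negbTE nuv) andbF.
rewrite !addn0; apply: eq_card => w.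
by rewrite !inE /flip (negbTE xu) (negbTE xv) !andbF.
Qed.

Lemma odd_indeg_flip o u v x : asym o -> und o u v ->
  odd (indeg (flip o u v) x) = odd (indeg o x) (+) (x == u) (+) (x == v).
Proof.
move=> ao /orP[] h; have := congr1 odd (indeg_flip x ao h); rewrite !oddD !oddb.
- by move=> <-; rewrite -addbA addbb addbF.
- rewrite (eq_indeg x (flipC o v u)) => e.
  by rewrite -[odd (indeg o x) (+) _ (+) _]addbA [(x == u) (+) _]addbC addbA -e -addbA addbb addbF.
Qed.

Lemma indeg_flip_other o u v x : x <> u -> x <> v -> indeg (flip o u v) x = indeg o x.
Proof.
move=> /eqP xu /eqP xv; apply: eq_card => w.
by rewrite !inE /flip (negbTE xu) (negbTE xv) !andbF.
Qed.

Definition claw_centers o := [set x | claw_center o x].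

(** Reversing the first edge makes the in-degree of [v] even and passes the odd parity on to [v'];
    the process stops at the first claw center met, which becomes even too. Midway, [v] may have
    in-degree 1, hence its exemption, or in-degree 3 for the time being, hence [:\ v] in the
    bound. *)
Lemma path_flip p : forall v o, asym o -> (forall x, #|[set y | und o x y]| <= 3) ->
  (forall x, x <> v -> indeg o x != 1) -> odd (indeg o v) -> path (und o) v p ->
  last v p <> v -> claw_center o (last v p) ->
  exists o', [/\ asym o', und o' =2 und o, forall x, indeg o' x != 1 &
    claw_centers o' \proper (claw_centers o :\ v)].
Proof.
elim: p => [|v' p IHp] v o ao do1 io ov //= /andP[vv' pp] lv cl.
have nvv' : v' != v.
  by apply: contraTneq vv' => ->; rewrite /und orbb; apply/negP=> h; move: (ao _ _ h); rewrite h.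
pose o1 := flip o v v'.
have ao1 : asym o1 by apply: asym_flip.
have u1 : und o1 =2 und o by apply: und_flip.
have evn : ~~ odd (indeg o1 v).
  by rewrite odd_indeg_flip // eqxx ov /= eq_sym (negbTE nvv').
have od : odd (indeg o1 v') = ~~ odd (indeg o v').
  by rewrite odd_indeg_flip // eqxx (negbTE nvv') addbF addbT.
have oth x : x <> v -> x <> v' -> indeg o1 x = indeg o x by apply: indeg_flip_other.
case: (boolP (claw_center o v')) => cv'.
  exists o1; split=> // [x|].
    case: (x =P v) => [->|xv]; first by apply: contraNneq evn => ->.
    case: (x =P v') => [->|xv']; last by rewrite oth ?io.
    by apply/eqP=> e; move: od; rewrite e (eqP cv').
  apply/properP; split.
    apply/subsetP=> x; rewrite !inE; case: (x =P v) => [->|xv].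
      by move=> /eqP e; rewrite e in evn.
    case: (x =P v') => [->|xv'] //; by rewrite /claw_center oth.
  exists v'; rewrite !inE ?nvv' //; apply/negP => /eqP e.
  by move: od; rewrite e (eqP cv').
have [|x xv'|||||o' [ao' uo' io' pr]] := IHp v' o1 ao1.
- by move=> x; rewrite (eq_card (B := [set y | und o x y])) // => y; rewrite !inE u1.
- case: (x =P v) => [->|xv]; first by apply: contraNneq evn => ->.
  by rewrite oth ?io.
(* The in-degree of [v'] is neither 1 nor 3, so it is even and the reversal makes it odd. *)
- rewrite od; have := io v' (elimN eqP nvv'); move: cv'; rewrite /claw_center.
  have : indeg o v' <= 3.
    apply: leq_trans (do1 v'); apply/subset_leq_card/subsetP=> u.
    by rewrite !inE /und orbC => ->.
  by case: (indeg o v') => [|[|[|[|]]]].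
- by rewrite (eq_path (e' := und o)).
- by move=> e; rewrite e (negbTE cv') in cl.
- rewrite /claw_center oth //; move=> e; by rewrite e (negbTE cv') in cl.
exists o'; split=> // [x y|]; first by rewrite uo' u1.
apply: proper_sub_trans pr _; apply/subsetP=> x; rewrite !inE => /andP[/eqP xv' c1].
case: (x =P v) => [e|xv] /=; last by rewrite /claw_center -oth.
by rewrite e /claw_center in c1; rewrite (eqP c1) in evn.
Qed.

Lemma eq_star o o' : star_orientation o -> asym o' -> und o' =2 und o ->
  (forall x, indeg o' x != 1) -> star_orientation o'.
Proof.
move=> so ao' u io'; split=> //.
- by move=> x; rewrite (eq_card (B := [set y | und o x y])) ?(so_deg so) // => y; rewrite !inE u.
- by move=> v a b c; rewrite !u; apply: (so_cf so).
Qed.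

Lemma one_claw_per_component o : star_orientation o ->
  exists o', [/\ star_orientation o', und o' =2 und o &
    forall t t', claw_center o' t -> claw_center o' t' -> connect (und o) t t' -> t = t'].
Proof.
move: {2}#|claw_centers o| (leqnn #|claw_centers o|) => n; elim: n o => [|n IHn] o.
  rewrite leqn0 cards_eq0 => /eqP c0 so; exists o; split=> // t t' ct.
  by have := in_set0 t; rewrite -c0 inE ct.
move=> cn so.
case: (classic (forall t t', claw_center o t -> claw_center o t' -> connect (und o) t t' -> t = t')).
  by exists o.
case/not_all_ex_not=> t /not_all_ex_not[t'] N.
have [ct [ct' [tt' ntt']]] : claw_center o t /\ claw_center o t' /\ connect (und o) t t' /\ t <> t'.
  by apply: NNPP => M; apply: N => ct ct' tt'; apply: NNPP => ne; apply: M.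
case/connectP: tt' => p pp lp; subst t'.
have odt : odd (indeg o t) by rewrite (eqP ct).
have [o' [ao' uo' io' pr]] := path_flip (so_asym so) (so_deg so) (fun x _ => so_in so x)
  odt pp (nesym ntt') ct'.
have [||o'' [so'' u'' h]] := IHn o'.
- rewrite -ltnS; apply: leq_trans (proper_card pr) (leq_trans _ cn).
  exact/subset_leq_card/subsetDl.
- exact: eq_star so ao' uo' io'.
exists o''; split=> // [x y|x x' cx cx']; first by rewrite u'' uo'.
by move=> xx'; apply: h => //; rewrite (eq_connect uo').
Qed.

End Flip.

(** * Relocating the claw center *)

Section Coloring.
Variable T : finType.
Implicit Types o : rel T.

Definition star_colorable o := exists o' col,
  [/\ star_orientation o', und o' =2 und o & proper_on o' (centers o') col].

(** Reversing [b -> t] makes [b] the claw center, with in-neighbors [a], [t], [b']. Now [a -> t],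
    and [b'] is a source not pointing to [t]: this is the configuration of [coloring_claw_src] with
    [b] and [t] exchanged. *)
Lemma swap_claw o t a b d b' : star_orientation o -> claw_center o t ->
  (forall x, claw_center o x -> x = t) ->
  o a t -> o b t -> o d t -> a <> b -> a <> d -> b <> d -> o a b ->
  ~~ source o d -> o b' b -> b' <> a -> source o b' -> star_colorable o.
Proof.
move=> so ct uct at_ bt dt nab nad nbd ab nd b'b nb'a sb'.
have nbt := irrF so bt; have nat_ := irrF so at_; have nb'b := irrF so b'b.
have nb't : b' <> t by move=> e; move: sb'; rewrite e (negbTE (clw_nsrc ct)).
have nb'd : b' <> d by move=> e; rewrite e (negbTE nd) in sb'.
have ib : indeg o b = 2.
  by apply: (indeg2 so); [apply: nsrc_in ab|apply/negP=> /uct].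
pose o1 := flip o b t; have i1 x := indeg_flip x (so_asym so) bt.
have u1 := und_flip o b t; rewrite -/o1 in i1 u1.
have it1 : indeg o1 t = 2.
  by move: (i1 t); rewrite eqxx (eqP ct) eq_sym (introF eqP nbt) !addn0 addn1 => -[].
have ib1 : indeg o1 b = 3.
  by move: (i1 b); rewrite eqxx (introF eqP nbt) ib addn0.
have io1 x : x <> b -> x <> t -> indeg o1 x = indeg o x.
  by move=> /eqP/negbTE xb /eqP/negbTE xt; move: (i1 x); rewrite xb xt !addn0.
have so1 : star_orientation o1.
  apply: (eq_star so) => // [|x]; first exact: asym_flip (so_asym so).
  case: (x =P b) => [->|xb]; first by rewrite ib1.
  case: (x =P t) => [->|xt]; first by rewrite it1.
  by rewrite io1 ?(so_in so).
have o1E x y : ~ (x = b /\ y = t) -> ~ (x = t /\ y = b) -> o1 x y = o x y.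
  move=> h1 h2; rewrite /o1 /flip; case: ifP => // /orP[] /andP[/eqP ? /eqP ?];
    by [case: h1|case: h2].
have [col pcol] : exists col, proper_on o1 (centers o1) col.
  apply: (@coloring_claw_src _ o1 so1 b a t b').
  - by rewrite /claw_center ib1.
  - move=> x; rewrite /claw_center; case: (x =P b) => // xb.
    case: (x =P t) => [->|xt]; first by rewrite it1.
    by rewrite io1 // => /uct.
  - by rewrite o1E // => -[].
  - by rewrite /o1 /flip !eqxx orbT.
  - by rewrite o1E // => -[].
  - exact: nat_.
  - exact: nesym.
  - exact: nesym.
  - by rewrite o1E // => -[] //.
  - by rewrite /source io1.
  - rewrite o1E; [|by case|by case]; apply/negP=> b't.
    by case: (clw_in so ct at_ bt dt nab nad nbd b't).
by exists o1, col.
Qed.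

Lemma eq_addK n k m : n + k = m -> n = m - k.
Proof. by move=> <-; rewrite addnK. Qed.

(** Balance of seven successive uses of [indeg_flip] at one vertex; the letters stand for the
    indicators that this vertex is [a], [d] and so on. *)
Lemma sum_flips n0 n1 n2 n3 n4 n5 n6 n7 a d s t b w w' :
  n1 + w = n0 + a -> n2 + w = n1 + s -> n3 + w' = n2 + s -> n4 + w' = n3 + d ->
  n5 + b = n4 + d -> n6 + b = n5 + a -> n7 + t = n6 + a ->
  n7 + (t + b * 2 + w * 2 + w' * 2) = n0 + (a * 3 + d * 2 + s * 2).
Proof. by lia. Qed.

Lemma flip_keep (o : rel T) p q u v : u <> p \/ v <> q -> u <> q \/ v <> p ->
  o u v -> flip o p q u v.
Proof.
move=> h1 h2; rewrite /flip; case: ifP => // /orP[] /andP[/eqP e /eqP e'];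
  by [case: h1|case: h2].
Qed.

Local Ltac neq := solve [assumption | apply: nesym; assumption].
Local Ltac keep_arc :=
  apply: flip_keep; [solve [left; neq | right; neq] | solve [left; neq | right; neq] | ].
Local Ltac drop_eq := case: eqP;
  [let h := fresh in intro h; exfalso; revert h; neq | intros _].

(* The arcs of the cycle [a w s w' d b] and the arc [a -> t] are reversed; this
   moves the claw center from [t] to [a]. *)
Lemma rotate_diamond o t a b d w w' s : star_orientation o -> claw_center o t ->
  (forall x, claw_center o x -> x = t) ->
  o a t -> o b t -> o d t -> a <> b -> a <> d -> b <> d -> o a b ->
  source o d -> o d b -> o a w -> o d w' -> source o s -> o s w -> o s w' ->
  w <> w' -> w <> t -> w <> b -> w' <> t -> w' <> b -> star_colorable o.
Proof.
move=> so ct uct at_ bt dt nab nad nbd ab sd db aw dw' ss sw sw' nww' nwt nwb nw't nw'b.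
have sa : source o a by apply: (two_outs_src so at_ ab); apply/nesym/(irrF so bt).
have srcN x y : source o x -> ~~ source o y -> x <> y by move=> sx ny e; rewrite -e sx in ny.
have nb := nsrc_in ab; have nt := nsrc_in bt; have nw := nsrc_in aw; have nw' := nsrc_in dw'.
have nat_ := srcN _ _ sa nt; have naw := srcN _ _ sa nw; have naw' := srcN _ _ sa nw'.
have ndt := srcN _ _ sd nt; have ndw := srcN _ _ sd nw; have ndw' := srcN _ _ sd nw'.
have nst := srcN _ _ ss nt; have nsw := srcN _ _ ss nw; have nsw' := srcN _ _ ss nw'.
have nsb := srcN _ _ ss nb; have nbt := irrF so bt.
have nsa : s <> a.
  move=> e; subst s; apply: (deg4F so (undl at_) (undl ab) (undl aw) (undl sw')) => //; exact: nesym.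
have nsd : s <> d.
  move=> e; subst s; apply: (deg4F so (undl dt) (undl db) (undl sw) (undl dw')) => //; exact: nesym.
have iE x : ~~ source o x -> x <> t -> indeg o x = 2.
  by move=> nx xt; apply: (indeg2 so) => //; apply/negP=> /uct.
have ib := iE b nb nbt; have iw := iE w nw nwt; have iw' := iE w' nw' nw't.
pose o1 := flip o a w; pose o2 := flip o1 s w; pose o3 := flip o2 s w'.
pose o4 := flip o3 d w'; pose o5 := flip o4 d b; pose o6 := flip o5 a b.
pose o7 := flip o6 a t.
have a0 := so_asym so; have a1 : asym o1 by apply: asym_flip.
have a2 : asym o2 by apply: asym_flip.
have a3 : asym o3 by apply: asym_flip.
have a4 : asym o4 by apply: asym_flip.
have a5 : asym o5 by apply: asym_flip.
have a6 : asym o6 by apply: asym_flip.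
have a7 : asym o7 by apply: asym_flip.
have sw1 : o1 s w by do 1!keep_arc.
have sw'2 : o2 s w' by do 2!keep_arc.
have dw'3 : o3 d w' by do 3!keep_arc.
have db4 : o4 d b by do 4!keep_arc.
have ab5 : o5 a b by do 5!keep_arc.
have at6 : o6 a t by do 6!keep_arc.
have i7 x : indeg o7 x + ((x == t) + (x == b) * 2 + (x == w) * 2 + (x == w') * 2) =
            indeg o x + ((x == a) * 3 + (x == d) * 2 + (x == s) * 2).
  exact: (sum_flips (indeg_flip x a0 aw) (indeg_flip x a1 sw1) (indeg_flip x a2 sw'2)
    (indeg_flip x a3 dw'3) (indeg_flip x a4 db4) (indeg_flip x a5 ab5) (indeg_flip x a6 at6)).
have ia7 : indeg o7 a = 3.
  move: (i7 a); rewrite eqxx (eqP sa); do 6!drop_eq.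
  by move/eq_addK.
have other x : x <> a -> indeg o7 x != 1 /\ indeg o7 x != 3.
  move=> xa; move: (i7 x).
  case: (x =P a) => // _.
  case: (x =P t) => [e|nxt].
    subst x; rewrite (eqP ct); do 5!drop_eq.
    by move/eq_addK->.
  case: (x =P b) => [e|_].
    subst x; rewrite ib; do 4!drop_eq.
    by move/eq_addK->.
  case: (x =P w) => [e|_].
    subst x; rewrite iw; do 3!drop_eq.
    by move/eq_addK->.
  case: (x =P w') => [e|_].
    subst x; rewrite iw'; do 2!drop_eq.
    by move/eq_addK->.
  case: (x =P d) => [e|_].
    subst x; rewrite (eqP sd); do 1!drop_eq.
    by move/eq_addK->.
  case: (x =P s) => [e|_]; first by subst x; rewrite (eqP ss) => /eq_addK->.
  by rewrite !mul0n !addn0 => ->; split; [apply: so_in so x|apply/negP=> /uct].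
have u7 x y : und o7 x y = und o x y by rewrite !und_flip.
have so7 : star_orientation o7.
  apply: (eq_star so) => // x.
  by case: (x =P a) => [->|/other[]//]; rewrite ia7.
have [col pcol] : exists col, proper_on o7 (centers o7) col.
  (* The claw center is now [a], with in-neighbors [b], [t], [w]; both [b] and [w] have become
     sources, [b] points to [t], and [w] is not adjacent to [t]. *)
  apply: (@coloring_claw_src _ o7 so7 a b t w).
  - by rewrite /claw_center ia7.
  - by move=> x cx; apply: NNPP => /other[_]; rewrite (eqP cx).
  - keep_arc.
    by rewrite /o6 /flip !eqxx orbT.
  - by rewrite /o7 /flip !eqxx orbT.
  - do 6!keep_arc.
    by rewrite /o1 /flip !eqxx orbT.
  - exact: nbt.
  - exact: nesym.
  - exact: nesym.
  - by do 7!keep_arc.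
  - rewrite /source; move: (i7 w); rewrite iw eqxx; do 6!drop_eq.
    by move/eq_addK->.
  - apply/negP=> h; have wt : und o w t by rewrite -u7 undl.
    case/orP: wt => [wt|tw].
      by case: (clw_in so ct at_ bt dt nab nad nbd wt) => e; subst w.
    by case: (clw_outF so ct tw).
by exists o7, col.
Qed.

Lemma star_coloring o : star_orientation o ->
  (forall t t', claw_center o t -> claw_center o t' -> t = t') -> star_colorable o.
Proof.
move=> so uc; have colored col : proper_on o (centers o) col -> star_colorable o.
  by move=> pc; exists o, col.
case: (pickP (claw_center o)) => [t ct|noc]; last first.
  suff [col /colored//] : exists col, proper_on o (centers o) col.
  apply: (coloring_of_low so) => S Sn S0 NL.
  have [c cS lc] := low_without_claw so (fun x => negbT (noc x)) Sn S0.
  exact: NL cS lc.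
have uct x : claw_center o x -> x = t by move=> cx; apply: uc.
have [a [b [d [[at_ bt dt] [[nab nad nbd] ab]]]]] :
    exists a b d, [/\ o a t, o b t & o d t] /\ [/\ a <> b, a <> d & b <> d] /\ o a b.
  have [x [y [z [[xt yt zt] [xy xz yz]]]]] := clw_ins ct.
  have yx := nesym xy; have zx := nesym xz; have zy := nesym yz.
  by case: (so_cf so (undr xt) (undr yt) (undr zt) xy xz yz) => /orP[] h;
    [exists x, y, z|exists y, x, z|exists x, z, y|exists z, x, y|exists y, z, x|exists z, y, x].
case: (boolP (source o d)) => sd.
  case: (boolP (o d b)) => db; last first.
    have [col /colored//] := coloring_claw_src so ct uct at_ bt dt nab nad nbd ab sd db.
  (* Were the goal false, the greedy argument would succeed: a set without a low member yields the
     cycle that [rotate_diamond] reverses. *)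
  apply: NNPP => N.
  suff [col /colored//] : exists col, proper_on o (centers o) col.
  apply: (coloring_of_low so) => S Sn S0 NL; apply: N.
  have [w [w' [s [[aw dw' ss sw sw'] [h1 h2 h3 h4 h5]]]]] :=
    claw_diamond_cycle so ct uct at_ bt dt nab nad nbd ab Sn S0 NL sd db.
  exact: (rotate_diamond so ct uct at_ bt dt nab nad nbd ab sd db aw dw' ss sw sw').
case: (classic (exists b', [/\ o b' b, b' <> a & source o b'])) => [[b' [b'b b'a sb']]|nb'].
  exact: (swap_claw so ct uct at_ bt dt nab nad nbd ab sd b'b b'a sb').
suff [col /colored//] : exists col, proper_on o (centers o) col.
apply: (coloring_of_low so) => S Sn S0 NL.
apply: (claw_nsrc_absurd so ct uct at_ bt dt nab nad nbd ab Sn S0 NL sd) => x xb xa.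
by apply/negP=> sx; apply: nb'; exists x.
Qed.

(** Colors sit on ordered pairs of vertices and in any [eqType]: the given coloring will take values
    in [option 'I_k], the constructed one in ['I_3]. *)
Definition edge_irregular (I : eqType) (e : rel T) (f : T -> T -> I) :=
  forall x y, e x y ->
    #|[set z | e x z && (f x z == f x y)]| != #|[set z | e y z && (f y z == f x y)]|.

Lemma star_colorable_irregular o : star_colorable o -> exists f : T -> T -> 'I_3,
  (forall x y, und o x y -> f x y = f y x) /\ edge_irregular (und o) f.
Proof.
case=> o' [col [so u pcol]]; exists (arc_color o' col); split=> [x y|].
  by rewrite -u => /(arc_color_sym so).
have key x y : o' x y ->
    #|[set z | und o x z && (arc_color o' col x z == col y)]| !=
    #|[set z | und o y z && (arc_color o' col y z == col y)]|.
  move=> xy; have := arc_color_irregular so pcol xy.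
  have E v : [set z | und o v z && (arc_color o' col v z == col y)] =
             [set z | und o' v z && (arc_color o' col v z == col y)].
    by apply/setP=> z; rewrite !inE u.
  by rewrite !E.
move=> x y; rewrite -u => xy; case/orP: (xy) => h.
  by rewrite {2 4}/arc_color h key.
by rewrite (arc_color_sym so _ xy) eq_sym {2 4}/arc_color h key.
Qed.

End Coloring.

(** * From a locally irregular coloring to a star orientation *)

Section LirOrientation.
Variables (T : finType) (G : sgraph T) (I : eqType) (f : T -> T -> I).
Hypothesis f_sym : forall x y, G x y -> f x y = f y x.
Hypothesis f_irr : edge_irregular G f.
Hypothesis deg3 : forall x, #|[set y | G x y]| <= 3.
Hypothesis cf : forall v a b c, G v a -> G v b -> G v c ->
  a <> b -> a <> c -> b <> c -> [\/ G a b, G a c | G b c].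

Definition cdeg x y := #|[set z | G x z && (f x z == f x y)]|.

Lemma adjC x y : G x y -> G y x.
Proof. by rewrite adj_sym. Qed.

Lemma adj_neq x y : G x y -> x <> y.
Proof. by move=> h e; rewrite e adj_irr in h. Qed.

Lemma cdeg_neq x y : G x y -> cdeg x y != cdeg y x.
Proof. by move=> xy; have := f_irr xy; rewrite /cdeg (f_sym xy). Qed.

Lemma cdeg_le3 x y : cdeg x y <= 3.
Proof.
apply: leq_trans (deg3 x); apply/subset_leq_card/subsetP=> z.
by rewrite !inE => /andP[].
Qed.

Lemma cdeg_gt0 x y : G x y -> 0 < cdeg x y.
Proof. by move=> xy; apply/card_gt0P; exists y; rewrite inE xy eqxx. Qed.

Lemma cdeg_eq x y z : f x y = f x z -> cdeg x y = cdeg x z.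
Proof. by rewrite /cdeg => ->. Qed.

Lemma cdeg3_all x y z : cdeg x y = 3 -> G x z -> f x z = f x y.
Proof.
move=> c3 xz; have /eqP e : [set z | G x z && (f x z == f x y)] == [set z | G x z].
  rewrite eqEcard -/(cdeg x y) c3 deg3 andbT.
  by apply/subsetP=> w; rewrite !inE => /andP[].
by have := in_set (G x) z; rewrite -e inE xz /= => /eqP.
Qed.

Lemma cdeg_other x y : G x y -> 1 < cdeg x y -> exists z, [/\ G x z, z <> y & f x z = f x y].
Proof.
move=> xy /card_gt1P[z [w [+ + zw]]]; rewrite !inE => /andP[xz /eqP fz] /andP[xw /eqP fw].
case: (z =P y) => [e|zy]; last by exists z.
by exists w; split=> // e'; rewrite e e' eqxx in zw.
Qed.

Lemma adj4F x a b c d : G x a -> G x b -> G x c -> G x d ->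
  a <> b -> a <> c -> a <> d -> b <> c -> b <> d -> c <> d -> False.
Proof. by move=> *; apply: (@card4F _ _ a b c d (deg3 x)); rewrite ?inE. Qed.

(* [v] would receive a single edge if every edge pointed to its endpoint of
   larger color degree. *)
Definition hungry v q := [&& G v q, cdeg v q == 2, cdeg q v == 3 &
  [exists p, [&& G v p, p != q, f v p == f v q & cdeg p v == 1]]].

(** A vertex [q] of color degree 3 returns its edges to its hungry neighbors. If exactly two are
    hungry, [q] would keep a single in-arc, so it returns all three edges. *)
Definition gives q x := hungry x q || (#|[set v | hungry v q]| == 2).

Definition lir_arc : rel T := fun x y => G x y &&
  (if cdeg x y < cdeg y x then ~~ ((cdeg y x == 3) && gives y x)
   else (cdeg x y == 3) && gives x y).

Lemma lir_arc_total x y : G x y -> lir_arc x y = ~~ lir_arc y x.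
Proof.
move=> xy; rewrite /lir_arc xy (adjC xy) /=.
by case: ltngtP (cdeg_neq xy) => //= _ _; rewrite ?negbK.
Qed.

Lemma lir_arc_max x y : G x y -> cdeg x y < cdeg y x -> cdeg y x != 3 -> lir_arc x y.
Proof. by move=> xy lt n3; rewrite /lir_arc xy lt (negbTE n3). Qed.

Lemma hungryP v q : hungry v q -> exists p,
  [/\ G v q, cdeg v q = 2 & cdeg q v = 3] /\ [/\ G v p, p <> q, f v p = f v q & cdeg p v = 1].
Proof.
case/and4P=> vq /eqP h2 /eqP h3 /existsP[p /and4P[vp /eqP pq /eqP fp /eqP p1]].
by exists p.
Qed.

(** All edges at [q] have the color of [qv]. If [vy] had it too, then either [y] is the vertex [p]
    of color degree 1, which would have two such edges, or [v] would have three. As [v] has no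
    neighbor besides [q], [p], [y], its edge to [y] is alone in its color. *)
Lemma hungry_third v q y : hungry v q -> G q y -> v <> y -> G v y ->
  f v y <> f v q /\ cdeg v y = 1.
Proof.
move=> hv qy nvy vy.
have [p [[vq v2 q3] [vp pq fp p1]]] := hungryP hv.
have fqy : f q y = f q v by apply: cdeg3_all.
have nf : f v y <> f v q.
  move=> e; case: (p =P y) => [py|py].
    have : 1 < cdeg y v.
      apply/card_gt1P; exists v, q; rewrite !inE (adjC vy) (adjC qy) eqxx /=; split=> //.
        by rewrite -(f_sym qy) fqy -(f_sym vq) -e (f_sym vy).
      by apply/eqP; apply: adj_neq vq.
    by rewrite -py p1.
  have : 2 < cdeg v q.
    apply/card_gt2P; exists q, p, y; rewrite !inE vq vp vy fp e eqxx /=; split=> //.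
    by split; apply/eqP => //; [apply: nesym|apply/nesym/(adj_neq qy)].
  by rewrite v2.
split=> //; apply/eqP; rewrite eqn_leq cdeg_gt0 // andbT; apply/card_le1_eqP => z z'.
have zy w : w \in [set z | G v z && (f v z == f v y)] -> w = y.
  rewrite inE => /andP[vw /eqP fw]; case: (w =P y) => // wy.
  case: (adj4F vq vp vy vw) => //; try exact: nesym.
  - exact: adj_neq qy.
  - by move=> e; apply: nf; rewrite -fw -e.
  - by move=> e; apply: nf; rewrite -e.
  - by move=> e; apply: nf; rewrite -fw -e.
by move=> /zy-> /zy->.
Qed.

Lemma lir_arc_other x y : lir_arc x y -> exists2 z, z <> x & lir_arc z y.
Proof.
move=> /andP[xy]; have yx := adjC xy; have nm := cdeg_neq xy; case: ltnP => lt.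
- rewrite negb_and => h; case: (cdeg y x =P 3) h => [y3 /=|y3 _].
  + rewrite /gives negb_or => /andP[nh n2].
    (* If all neighbors of [y] other than [x] were hungry, exactly two would be, and [y] would give
       up the edge from [x]. *)
    have [z [yz zx nz]] : exists z, [/\ G y z, z <> x & ~~ hungry z y].
      apply: NNPP => N; case/eqP: n2.
      have -> : [set v | hungry v y] = [set z | G y z] :\ x.
        apply/setP=> z; rewrite !inE; apply/idP/andP => [hz|[/eqP zx yz]].
          split; last by case/and4P: hz => /adjC.
          by apply: contraNneq nh => <-.
        by apply/negPn/negP=> nz; apply: N; exists z.
      have : #|[set z | G y z]| = 3.
        apply/eqP; rewrite eqn_leq deg3 -y3; apply/subset_leq_card/subsetP=> z.
        by rewrite !inE => /andP[].
      by rewrite (cardsD1 x) inE yx => -[].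
    exists z => //; have e : cdeg y z = 3 by rewrite (cdeg_eq (cdeg3_all y3 yz)).
    rewrite /lir_arc (adjC yz) e eqxx /gives negb_or nz n2.
    by have := cdeg_neq yz; rewrite e; have := cdeg_le3 z y; case: (cdeg z y) => [|[|[|[|]]]].
  + have y2 : cdeg y x = 2.
      have := cdeg_le3 y x; move: y3 lt (cdeg_gt0 xy).
      by case: (cdeg y x) => [|[|[|[|]]]] // _; case: (cdeg x y) => [|[]].
    have x1 : cdeg x y = 1.
      by move: lt (cdeg_gt0 xy); rewrite y2; case: (cdeg x y) => [|[|]].
    have [|z [yz zx fz]] := cdeg_other yx; first by rewrite y2.
    have z2 : cdeg y z = 2 by rewrite (cdeg_eq fz).
    exists z => //; have := cdeg_neq yz; rewrite z2 => nz.
    have := cdeg_le3 z y; move: nz (cdeg_gt0 (adjC yz)).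
    case E: (cdeg z y) => [|[|[|[|]]]] // _ _ _.
      by apply: lir_arc_max; rewrite ?E ?z2 // adjC.
    (* Here [z] has color degree 3 and [x] has color degree 1, so [y] is hungry at [z] and gets the
       edge back. *)
    rewrite /lir_arc (adjC yz) E z2 /=; apply/orP; left.
    rewrite /hungry yz z2 E !eqxx /=; apply/existsP; exists x.
    by rewrite yx x1 fz !eqxx !andbT; apply/eqP/nesym.
- case/andP=> /eqP x3; rewrite /gives; case: (boolP (hungry y x)) => [hy _|ny /= /eqP h2].
  + have [p [[_ y2 _] [yp px fp p1]]] := hungryP hy; exists p => //.
    by apply: lir_arc_max; rewrite ?p1 ?(cdeg_eq fp) ?y2 // adjC.
  (* Now [y] is the one neighbor of [x] that is not hungry. Claw-freeness at [x] gives an edge among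
     [y] and the two hungry neighbors; a hungry neighbor adjacent to [y] supplies the second
     in-arc. *)
  + have : 1 < #|[set v | hungry v x]| by rewrite h2.
    case/card_gt1P=> v [v' [+ + /eqP vv']]; rewrite !inE => hv hv'.
    have ny' w : hungry w x -> w <> y by move=> hw e; rewrite -e hw in ny.
    have take_ w : hungry w x -> G w y -> exists2 z, z <> x & lir_arc z y.
      move=> hw wy; have [_ [[wx w2 _] _]] := hungryP hw.
      have [nf w1] := hungry_third hw xy (ny' w hw) wy.
      exists w; first exact: adj_neq wx.
      apply: lir_arc_max; rewrite // ?w1.
        by have := cdeg_neq wy; have := cdeg_gt0 (adjC wy); rewrite w1; case: (cdeg y w) => [|[]].
      apply/eqP=> y3; apply: nf.
      have := cdeg3_all y3 yx; rewrite -(f_sym wy) => <-.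
      by rewrite -(f_sym xy) (f_sym wx) (cdeg3_all x3 (adjC wx)).
    have [_ [[vx v2 _] _]] := hungryP hv; have [_ [[v'x v'2 _] _]] := hungryP hv'.
    case: (cf (adjC vx) (adjC v'x) xy vv' (ny' v hv) (ny' v' hv')) => [h|h|h].
    (* Two adjacent hungry neighbors would both have color degree 1 on their common edge, against
       local irregularity. *)
    * have [_ e1] := hungry_third hv (adjC v'x) vv' h.
      have [_ e2] := hungry_third hv' (adjC vx) (nesym vv') (adjC h).
      by have := cdeg_neq h; rewrite e1 e2.
    * exact: take_ hv h.
    * exact: take_ hv' h.
Qed.

Lemma und_lir_arc : und lir_arc =2 G.
Proof.
move=> x y; rewrite /und; apply/orP/idP => [[/andP[]//|/andP[/adjC]//]|xy].
by rewrite (lir_arc_total xy); case: (lir_arc y x); [right|left].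
Qed.

Lemma star_lir_arc : star_orientation lir_arc.
Proof.
split.
- by move=> x y xy; rewrite -lir_arc_total //; case/andP: xy.
- by move=> x; rewrite (eq_card (B := [set y | G x y])) ?deg3 // => y; rewrite !inE und_lir_arc.
- by move=> v a b c; rewrite !und_lir_arc; apply: cf.
- move=> x; apply/negP=> /cards1P[u eu].
  have : u \in [set u | lir_arc u x] by rewrite eu set11.
  rewrite inE => /lir_arc_other[z zu zx].
  have : z \in [set u | lir_arc u x] by rewrite inE.
  by rewrite eu inE => /eqP.
Qed.

End LirOrientation.

(** * Coloring each connected component separately *)

Section Gluing.
Variables (T : finType) (o : rel T).
Hypothesis so : star_orientation o.
Hypothesis one_claw : forall t t', claw_center o t -> claw_center o t' ->
  connect (und o) t t' -> t = t'.

(** The vertex set is kept; vertices outside the component of [r] become isolated, hence sources. *)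
Definition component_arcs r : rel T := fun x y => o x y && connect (und o) r x.

Lemma und_sym : symmetric (und o).
Proof. by move=> x y; rewrite /und orbC. Qed.

Lemma connect_und_sym : connect_sym (und o).
Proof. exact: sym_connect_sym und_sym. Qed.

Lemma connect_arc r x y : und o x y -> connect (und o) r x = connect (und o) r y.
Proof. by move=> xy; rewrite !(connect_und_sym r) (same_connect connect_und_sym (connect1 xy)). Qed.

Lemma und_component r x y : und (component_arcs r) x y = und o x y && connect (und o) r x.
Proof.
rewrite /und /component_arcs; case: (boolP (o x y)) => xy /=.
  by case: connect => //=; rewrite (negbTE (so_asym so xy)).
by case: (boolP (o y x)) => //= yx; rewrite (connect_arc r (undr yx)).
Qed.

Lemma indeg_component r x :
  indeg (component_arcs r) x = if connect (und o) r x then indeg o x else 0.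
Proof.
case: ifP => c; last first.
  apply: eq_card0 => u; rewrite !inE; apply/negP=> /andP[ux].
  by rewrite (connect_arc r (undl ux)) c.
apply: eq_card => u; rewrite !inE /component_arcs; case: (boolP (o u x)) => //= ux.
by rewrite (connect_arc r (undl ux)).
Qed.

Lemma star_component r : star_orientation (component_arcs r).
Proof.
split.
- by move=> x y /andP[xy _]; rewrite /component_arcs (negbTE (so_asym so xy)).
- move=> x; apply: leq_trans (so_deg so x); apply/subset_leq_card/subsetP=> y.
  by rewrite !inE und_component => /andP[].
- move=> v a b c; rewrite !und_component => /andP[va vr] /andP[vb _] /andP[vc _] ab ac bc.
  have ar : connect (und o) r a by rewrite -(connect_arc r va).
  have br : connect (und o) r b by rewrite -(connect_arc r vb).
  by rewrite ar br !andbT; apply: (so_cf so va vb vc).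
- by move=> x; rewrite indeg_component; case: ifP => // _; apply: so_in.
Qed.

Lemma component_coloring r : exists f : {ffun T * T -> 'I_3},
  (forall x y, und o x y -> connect (und o) r x -> f (x, y) = f (y, x)) /\
  (forall x y, und o x y -> connect (und o) r x ->
    #|[set z | und o x z && (f (x, z) == f (x, y))]| !=
    #|[set z | und o y z && (f (y, z) == f (x, y))]|).
Proof.
have [|f [fs fi]] := star_colorable_irregular (star_coloring (star_component r) _).
  move=> t t'; rewrite /claw_center !indeg_component.
  case: ifP => // rt ct; case: ifP => // rt' ct'; apply: one_claw => //.
  by apply: connect_trans rt'; rewrite connect_und_sym.
exists [ffun p => f p.1 p.2]; split=> x y xy rx; rewrite !ffunE /=.
  by apply: fs; rewrite und_component xy rx.
have ry : connect (und o) r y by rewrite -(connect_arc r xy).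
have := fi x y; rewrite und_component xy rx => /(_ isT).
rewrite (eq_card (B := [set z | und o x z && ([ffun p => f p.1 p.2] (x, z) == f x y)])); last first.
  by move=> z; rewrite !inE und_component rx andbT ffunE.
rewrite [X in _ != X](eq_card (B := [set z | und o y z && ([ffun p => f p.1 p.2] (y, z) == f x y)])) //.
by move=> z; rewrite !inE und_component ry andbT ffunE.
Qed.

Lemma glued_coloring : exists f : T -> T -> 'I_3,
  (forall x y, und o x y -> f x y = f y x) /\ edge_irregular (und o) f.
Proof.
have [F hF] := fin_all_exists component_coloring.
pose rt := root (und o).
have rtE x y : und o x y -> rt y = rt x.
  by move=> xy; apply/eqP; rewrite eq_sym root_connect ?connect1 //; apply: connect_und_sym.
have crt x : connect (und o) (rt x) x by rewrite connect_und_sym connect_root.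
exists (fun x y => F (rt x) (x, y)); split=> x y xy.
  by rewrite (rtE x y xy); apply: (hF _).1.
have := (hF (rt x)).2 x y xy (crt x).
by rewrite (rtE x y xy).
Qed.

End Gluing.

(** * Translation between colorings of edges and symmetric functions on pairs of vertices *)

Section Transfer.
Variables (T : finType) (G : sgraph T).

Lemma mem_edges x y : G x y -> [set x; y] \in edges G.
Proof. by move=> xy; apply/imsetP; exists (x, y); rewrite ?inE. Qed.

Lemma lir_coloring_irregular k (c : edge_coloring G k) : lir_coloring c ->
  exists f : T -> T -> option 'I_k,
    (forall x y, G x y -> f x y = f y x) /\ edge_irregular G f.
Proof.
(* The value is [None] exactly on the pairs that are not edges. *)
move=> /forallP lir; pose f x y := [pick i | color_adj c i x y].
have colU x y i j : color_adj c i x y -> color_adj c j x y -> i = j.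
  case/existsP=> e /andP[/eqP ve /eqP <-] /existsP[e' /andP[/eqP ve' /eqP <-]].
  by congr (c _); apply: val_inj; rewrite ve ve'.
have fP x y i : (f x y == Some i) = color_adj c i x y.
  rewrite /f; case: pickP => [j cj|no]; last by rewrite no.
  apply/eqP/idP => [[<-]//|ci]; by rewrite (colU _ _ _ _ ci cj).
have colG x y i : color_adj c i x y -> G x y.
  by case/existsP=> e /andP[/eqP /edge_adj].
have fG x y : G x y -> exists i, f x y = Some i.
  move=> xy; pose e : edge G := exist (fun s => s \in edges G) _ (mem_edges xy); exists (c e); apply/eqP.
  by rewrite fP; apply/existsP; exists e; rewrite !eqxx.
exists f; split=> [x y /fG[i e]|x y xy].
  by rewrite e; apply/esym/eqP; rewrite fP color_adj_sym -fP e.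
have [i e] := fG x y xy; rewrite e.
have E v : [set z | G v z && (f v z == Some i)] = [set z | color_subgraph c i v z].
  apply/setP=> z; rewrite !inE fP /=; apply: andb_idl; exact: colG.
rewrite !E; have /forallP/(_ x)/forallP/(_ y)/implyP := lir i; apply.
by rewrite /= -fP e.
Qed.

Lemma irregular_lir_colorable k (f : T -> T -> 'I_k) :
  (forall x y, G x y -> f x y = f y x) -> edge_irregular G f -> lir_colorable G k.
Proof.
move=> f_sym f_irr.
have edgeP (e : edge G) : exists p : T * T, val e == [set p.1; p.2].
  by case: e => s /= /imsetP[p _ ->]; exists p.
(* The ends of an edge come in an arbitrary order; the symmetry of [f] makes the choice harmless. *)
pose c : edge_coloring G k := [ffun e => let p := xchoose (edgeP e) in f p.1 p.2].
have colE i x y : color_adj c i x y = G x y && (f x y == i).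
  apply/existsP/andP => [[e /andP[/eqP ve]]|[xy fi]].
    have xy := edge_adj ve; rewrite ffunE /=; set p := xchoose _.
    have /eqP := xchooseP (edgeP e); rewrite -/p ve => E.
    have px : p.1 \in [set x; y] by rewrite E set21.
    have py : p.2 \in [set x; y] by rewrite E set22.
    have Gp : G p.1 p.2 by apply: (@edge_adj _ _ e); rewrite ve E.
    move: px py Gp; rewrite !inE => /orP[] /eqP-> /orP[] /eqP->; rewrite ?adj_irr //.
    by rewrite -f_sym.
  pose e : edge G := exist (fun s => s \in edges G) _ (mem_edges xy); exists e; rewrite eqxx /= ffunE /=.
  set p := xchoose _; have /eqP /= E := xchooseP (edgeP e); rewrite -/p in E.
  have px : p.1 \in [set x; y] by rewrite E set21.
  have py : p.2 \in [set x; y] by rewrite E set22.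
  have Gp : G p.1 p.2 by apply: (@edge_adj _ _ e); rewrite /= E.
  move: px py Gp; rewrite !inE => /orP[] /eqP-> /orP[] /eqP->; rewrite ?adj_irr //.
  by rewrite -f_sym.
apply/existsP; exists c; apply/forallP=> i; apply/forallP=> x; apply/forallP=> y.
apply/implyP; rewrite /= colE => /andP[xy /eqP <-].
have E v : deg (color_subgraph c (f x y)) v = #|[set z | G v z && (f v z == f x y)]|.
  by apply: eq_card => z; rewrite !inE /= colE.
by rewrite !E; apply: f_irr.
Qed.

Lemma claw_free_neighbors v a b c : claw_free G -> G v a -> G v b -> G v c ->
  a <> b -> a <> c -> b <> c -> [\/ G a b, G a c | G b c].
Proof.
move=> cfG va vb vc /eqP ab /eqP ac /eqP bc; apply: NNPP => N; apply: cfG.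
have [nab [nac nbc]] : G a b = false /\ G a c = false /\ G b c = false.
  by do !split; apply/negP=> h; apply: N; [constructor 1|constructor 2|constructor 3].
pose s := [:: a; b; c].
have us : uniq s by rewrite /= !inE !negb_or ab ac bc.
have vs z : z \in s -> G v z by rewrite !inE => /or3P[] /eqP->.
have ss z z' : z \in s -> z' \in s -> G z z' = false.
  rewrite !inE => /or3P[] /eqP-> /or3P[] /eqP->; rewrite ?adj_irr //; by rewrite adj_sym.
have ms (i : 'I_3) : nth v s i \in s by apply: mem_nth.
(* The center of the claw goes to [v] and its leaves to [a], [b], [c]; [v] is also the default of
   [nth], never reached. *)
exists (fun i => if i is Some j then nth v s (j : 'I_3) else v); split.
- move=> [i|] [j|] //.
  + by move/eqP; rewrite nth_uniq // => /eqP/val_inj->.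
  + by move=> e; have := vs _ (ms i); rewrite e adj_irr.
  + by move=> e; have := vs _ (ms j); rewrite -e adj_irr.
- move=> [i|] [j|]; rewrite /= /claw_adj /=.
  + by rewrite ss ?ms.
  + by rewrite adj_sym vs ?ms.
  + by rewrite vs ?ms.
  + exact: adj_irr.
Qed.

End Transfer.

Theorem theorem3 (T : finType) (G : sgraph T)
    (max_deg3 : max_deg G = 3) (cfG : claw_free G) (dG : decomposable G) :
  chi_irr dG <= 3.
Proof.
suff col3 : lir_colorable G 3 by rewrite /chi_irr; case: ex_minnP => m _; apply.
have [k /existsP[c /lir_coloring_irregular[f [f_sym f_irr]]]] := dG.
have deg3 x : #|[set y | G x y]| <= 3 by rewrite -max_deg3; apply: (leq_bigmax x).
have cf v a b c' := @claw_free_neighbors T G v a b c' cfG.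
have so := star_lir_arc f_sym f_irr deg3 cf.
have uG := und_lir_arc f_sym f_irr.
have [o [so' uo one_claw]] := one_claw_per_component so.
have [|g [g_sym g_irr]] := glued_coloring so'.
  by move=> t t' ct ct' tt'; apply: one_claw => //; rewrite -(eq_connect uo).
have oG x y : und o x y = G x y by rewrite uo uG.
apply: (irregular_lir_colorable (f := g)) => [x y xy|x y xy].
  by apply: g_sym; rewrite oG.
have := g_irr x y; rewrite oG => /(_ xy).
have E v : [set z | und o v z && (g v z == g x y)] = [set z | G v z && (g v z == g x y)].
  by apply/setP=> z; rewrite !inE oG.
by rewrite !E.
Qed.
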